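(* Let $K$ be a number field, $p$ an odd prime, $\mathfrak{p}$ a prime of $K$ above $p$ with ramification index not divisible by $p$ and with $K_{\mathfrak{p}}\cap\mathbb{Q}_p(\zeta_{p^\infty})=\mathbb{Q}_p$. Let $n=n_0p^m$ with $m\ge1$, $p\nmid n_0$, and let $a\in\mathcal{O}_K$ be such that $x^n-a$ is irreducible in $K[x]$, where $a=a_0\pi^{hp^k}$ with $\pi\in\mathcal{O}_K$, $v_{\mathfrak{p}}(\pi)=1$, $v_{\mathfrak{p}}(a_0)=0$, $p\nmid h$, $k\ge1$. Let $L=K(\sqrt[p^m]{a})$, where $\sqrt[p^m]{a}=(\sqrt[n]{a})^{n_0}$, let $\mathfrak{P}$ be a prime of $L$ above $\mathfrak{p}$ with residue field $k_{\mathfrak{P}}$, let $\pi_{\mathfrak{P}}$ be an element of $L$ with $v_{\mathfrak{P}}(\pi_{\mathfrak{P}})=1$, and let $g_{\mathfrak{P}}=\gcd(n_0,v_{\mathfrak{P}}(a))$. Then in $K(\sqrt[n]{a})$ we have $\mathfrak{P}=\mathfrak{I}^{n_0/g_{\mathfrak{P}}}$, where the factorization of $\mathfrak{I}$ mirrors the factorization of $y^{g_{\mathfrak{P}}}-\overline{a/\pi_{\mathfrak{P}}^{v_{\mathfrak{P}}(a)}}$ in $k_{\mathfrak{P}}[y]$ (bar denoting reduction modulo $\mathfrak{P}$).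
   Context: $\zeta_{p^j}$ is a primitive $p^j$-th root of unity and $\mathbb{Q}_p(\zeta_{p^\infty})=\bigcup_j\mathbb{Q}_p(\zeta_{p^j})$. ''The factorization of $\mathfrak{I}$ mirrors that of $R(y)\in k_{\mathfrak{P}}[y]$'' means: if $R=\gamma_1\cdots\gamma_s$ with distinct monic irreducible $\gamma_j$, then $\mathfrak{I}=\mathfrak{Q}_1\cdots\mathfrak{Q}_s$ with distinct primes $\mathfrak{Q}_j$ of $K(\sqrt[n]{a})$ above $\mathfrak{P}$, $\mathfrak{Q}_j$ of residue class degree $\deg\gamma_j$ over $\mathfrak{P}$. *)

(* Defs.v *)
From mathcomp Require Import all_boot all_order all_algebra all_field.
From mathcomp Require Import classical_sets.
Set Implicit Arguments.
Unset Strict Implicit.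
Unset Printing Implicit Defensive.
Import GRing.Theory Num.Theory.
Local Open Scope classical_set_scope.
Local Open Scope ring_scope.

(* Number fields are fields E with E : fieldExtType rat, or finite extensions
   of such fields; the notions below only use the underlying field. *)

Section Ideals.
Variable E : fieldType.
Implicit Types (I J P : set E) (x y : E).

Definition ringInt : set E := [set x | integralOver (intr : int -> E) x].

(* Ideals of ringInt, as subsets of E. *)
Definition is_ideal I : Prop :=
  [/\ I `<=` ringInt, I 0, (forall x y, I x -> I y -> I (x + y))
    & (forall x y, ringInt x -> I y -> I (x * y))].

(* A prime of a number field is a nonzero prime ideal of its ring of
   integers. *)
Definition is_prime P : Prop :=
  [/\ is_ideal P, (exists2 x, P x & x != 0), ~ P 1
    & forall x y, ringInt x -> ringInt y -> P (x * y) -> P x \/ P y].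

Definition ideal_mul I J : set E :=
  [set x | exists s : seq (E * E),
     (forall u, u \in s -> I u.1 /\ J u.2) /\ x = \sum_(u <- s) u.1 * u.2].

Definition ideal_exp I (n : nat) : set E := iter n (ideal_mul I) ringInt.

Definition ideal_prod (s : nat) (Q : 'I_s -> set E) : set E :=
  \big[ideal_mul/ringInt]_(j < s) Q j.

Definition exact_pow P x (n : nat) : Prop :=
  ideal_exp P n x /\ ~ ideal_exp P n.+1 x.

(* has_val P x e means that x is nonzero and v_P(x) = e. *)
Definition has_val P x (e : int) : Prop :=
  exists (y z : E) (i j : nat),
    [/\ exact_pow P y i, exact_pow P z j, x = y / z & e = i%:Z - j%:Z].

(* The P-adic valuation; its value at 0 is a junk value, so statements that
   prescribe v_P(x) also have to require x != 0, unless the prescribed value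
   is nonzero. *)
Definition vP P x : int := xget 0 (has_val P x).

Definition above_rat (p : nat) P : Prop :=
  [set z : int | P z%:~R] = [set z : int | (p %| z)%Z].

(* For P above p, the exponent of P in the factorization of the ideal (p). *)
Definition ram_index (p : nat) P : int := vP P p%:R.

(* k, with the map red, is the residue field of P: red restricts to a
   surjective ring morphism from ringInt onto k with kernel P, extended to the
   localization of ringInt at P; the values of red elsewhere are irrelevant. *)
Definition is_residue_field P (k : fieldType) (red : E -> k) : Prop :=
  [/\ red 1 = 1,
      (forall x y, ringInt x -> ringInt y ->
         red (x + y) = red x + red y /\ red (x * y) = red x * red y),
      (forall x, ringInt x -> (red x = 0 <-> P x)),
      (forall c, exists2 x, ringInt x & red x = c)
    & (forall x s, ringInt x -> ringInt s -> ~ P s ->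
         red (x / s) = red x / red s)].

End Ideals.

Section Extensions.
Variables (E F : fieldType) (f : E -> F).

Definition ideal_ext (I : set E) : set F :=
  [set y | exists s : seq (E * F),
     (forall u, u \in s -> I u.1 /\ ringInt u.2) /\
     y = \sum_(u <- s) f u.1 * u.2].

Definition lies_over (P : set E) (Q : set F) : Prop := f @^-1` Q = P.

(* The residue field of Q has a basis with d elements over that of P; the
   scalars c i and the basis elements b i are given by lifts to the rings of
   integers. *)
Definition residue_degree (P : set E) (Q : set F) (d : nat) : Prop :=
  exists b : 'I_d -> F,
    [/\ (forall i, ringInt (b i)),
        (forall y, ringInt y -> exists2 c : 'I_d -> E,
           (forall i, ringInt (c i)) & Q (y - \sum_(i < d) f (c i) * b i))
      & (forall c : 'I_d -> E, (forall i, ringInt (c i)) ->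
           Q (\sum_(i < d) f (c i) * b i) -> forall i, P (c i))].

Definition mirrors (P : set E) (k : fieldType) (I : set F) (R : {poly k})
    : Prop :=
  forall (s : nat) (gamma : 'I_s -> {poly k}),
    injective gamma ->
    (forall j, gamma j \is monic /\ irreducible_poly (gamma j)) ->
    R = \prod_(j < s) gamma j ->
    exists Q : 'I_s -> set F,
      [/\ injective Q,
          (forall j, is_prime (Q j) /\ lies_over P (Q j)),
          (forall j, residue_degree P (Q j) (size (gamma j)).-1)
        & I = ideal_prod Q].

End Extensions.

Section Completion.
Variables (F : fieldType) (w : F -> int).

(* As for vP, the value of w at 0 is irrelevant. *)
Definition is_valuation : Prop :=
  (forall x y, x != 0 -> y != 0 -> w (x * y) = w x + w y) /\
  (forall x y, x != 0 -> y != 0 -> x + y != 0 ->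
     Num.min (w x) (w y) <= w (x + y)).

Definition vclose (N : int) (x y : F) : Prop := x = y \/ N <= w (x - y).

Definition vcauchy (u : nat -> F) : Prop :=
  forall N, exists i0 : nat, forall i j : nat,
    (i0 <= i)%N -> (i0 <= j)%N -> vclose N (u i) (u j).

Definition vlimit (u : nat -> F) (l : F) : Prop :=
  forall N, exists i0 : nat, forall i : nat, (i0 <= i)%N -> vclose N (u i) l.

Definition vcomplete : Prop := forall u, vcauchy u -> exists l, vlimit u l.

Definition vclosure (A : set F) : set F :=
  [set x | forall N, exists2 y, A y & vclose N x y].

(* The field of p-adic numbers inside a completion at a prime above p. *)
Definition padic_subfield : set F := vclosure (range (ratr : rat -> F)).

End Completion.

(* (Kp, iota, w) is the completion of K at the prime P. *)
Definition is_completion (K : fieldType) (P : set K) (Kp : fieldType)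
    (iota : K -> Kp) (w : Kp -> int) : Prop :=
  [/\ is_valuation w, (forall x, x != 0 -> w (iota x) = vP P x),
      vclosure w (range iota) = setT & vcomplete w].

Definition gen_field (W : fieldType) (A : set W) : set W :=
  [set x | forall S : {pred W}, divring_closed S ->
     (forall y, A y -> y \in S) -> x \in S].

(* The union over j of the fields A(zeta), zeta a primitive p^j-th root of
   unity. *)
Definition cyclotomic_tower (W : fieldType) (p : nat) (A : set W) : set W :=
  [set x | exists (j : nat) (zeta : W),
     (p ^ j)%N.-primitive_root zeta /\ gen_field (A `|` [set zeta]) x].

(* Main.v *)
(** Let gam = alpha^(p^m), so that M = L(gam) and gam^n0 = a, and write
    v_P(a) = g v1, n0 = g e with gcd(e, v1) = 1.  Giving X the value v1/e extends
    v_P to a Gauss valuation W on L[X].  The part of value 0 of a polynomial with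
    W >= 0 involves only the monomials X^(e i); reading off their coefficients
    gives a ring morphism rho from {W >= 0} to k_P[y] with kernel {W > 0}, which
    sends the minimal polynomial X^n0 - a of gam, divided by pi^v_P(a), to
    R = y^g - a/pi^v_P(a).  As p does not divide g, R is separable, so k_P[y]/(R)
    is reduced; a power of an integral element of negative value, rescaled to
    value 0, would be nilpotent there.  Hence, locally at P, O_M is the image of
    {W >= 0} under X |-> gam, the ideal I of elements of positive value satisfies
    I^w = {e W >= w}, so that P O_M = I^e, and O_M/I = k_P[y]/(R); the primes are
    the preimages of the factors of R.

    That the localization of O_L at P is a discrete valuation ring comes from the
    finiteness of O_L/p: it yields b outside p O_(L,P) with b P in p O_(L,P), and
    b/p would be integral if it mapped P into P. *)

From HB Require Import structures.
Require Import Defs.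
From mathcomp Require Import all_boot all_order all_algebra all_field.
From mathcomp Require Import classical_sets boolp ring zify.
Set Implicit Arguments.
Unset Strict Implicit.
Unset Printing Implicit Defensive.
Import Order.TTheory GRing.Theory Num.Theory.
Local Open Scope classical_set_scope.
Local Open Scope ring_scope.

Definition Oint (E : fieldType) : {pred E} := fun x => `[< ringInt x >].
Arguments Oint : clear implicits.

Lemma OintP (E : fieldType) (x : E) : reflect (ringInt x) (x \in Oint E).
Proof. exact: asboolP. Qed.

Lemma Oint_subring_closed (E : fieldType) : subring_closed (Oint E).
Proof.
split=> [|x y|x y]; first by apply/OintP/integral1.
- by move=> /OintP Ix /OintP Iy; apply/OintP/integral_sub.
- by move=> /OintP Ix /OintP Iy; apply/OintP/integral_mul.
Qed.

HB.instance Definition _ (E : fieldType) :=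
  GRing.isSubringClosed.Build E (Oint E) (@Oint_subring_closed E).

Lemma Oint_int (E : fieldType) (z : int) : z%:~R \in Oint E.
Proof. by rewrite rpred_int. Qed.

Lemma Oint_root (E : fieldType) (q : {poly E}) (x : E) :
  q \is monic -> (forall i, q`_i \in Oint E) -> root q x -> x \in Oint E.
Proof.
move=> q_mon q_int qx; apply/OintP; apply: (integral_root_monic q_mon qx).
by apply/integral_poly => i; apply/OintP.
Qed.

Lemma Oint_expr_root (E : fieldType) (x : E) n :
  (0 < n)%N -> x ^+ n \in Oint E -> x \in Oint E.
Proof.
move=> n_gt0 xn; apply: (@Oint_root _ ('X^n - (x ^+ n)%:P)).
- by rewrite monicE lead_coefDl ?lead_coefXn ?size_polyN ?size_polyC ?size_polyXn //;
    case: (x ^+ n != 0).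
- move=> i; rewrite coefB coefXn coefC.
  by case: eqP => _; case: eqP => _; rewrite ?rpredB ?rpred0 ?rpred1.
- by rewrite /root !hornerE subrr.
Qed.

Lemma Oint_rmorph (E F : fieldType) (f : {rmorphism E -> F}) (x : E) :
  (f x \in Oint F) = (x \in Oint E).
Proof.
have root_f (q : {poly int}) : root (map_poly intr q) (f x) = root (map_poly intr q) x.
  rewrite -(fmorph_root f) -map_poly_comp; congr (root _ _).
  by apply: eq_map_poly => z /=; rewrite rmorph_int.
by apply/OintP/OintP => -[q q_mon qx]; exists q; rewrite // ?root_f // -root_f.
Qed.

(** * Integers of a number field modulo p *)

Section NumberField.
Variable E : fieldExtType rat.
Local Notation A := (Oint E).


Lemma intr_numfield_eq0 (z : int) : (z%:~R == 0 :> E) = (z == 0).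
Proof.
have -> : z%:~R = z%:~R%:A :> E by rewrite -[RHS]/(in_alg E _) rmorph_int.
by rewrite scaler_eq0 oner_eq0 orbF intr_eq0.
Qed.

Lemma int_poly_vanishing (x : E) :
  exists2 q : {poly int}, q != 0 & root (map_poly intr q) x.
Proof.
have /polyOver1P [q0 q0E] := minPolyOver 1%AS x.
have [q [c c_neq0 qE]] := rat_poly_scale q0.
exists q.
  apply/eqP => q_eq0; have := monic_neq0 (monic_minPoly 1%AS x).
  by rewrite q0E qE q_eq0 map_poly0 scaler0 map_poly0 eqxx.
have := root_minPoly 1%AS x; rewrite q0E qE map_polyZ rootZ; last first.
  by rewrite fmorph_eq0 invr_eq0 intr_eq0.
rewrite -map_poly_comp; congr (root _ x).
by apply: eq_map_poly => z /=; rewrite -[LHS]/(in_alg E _) rmorph_int.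
Qed.

Lemma Oint_scale (x : E) : exists2 m : int, m != 0 & m%:~R * x \in A.
Proof.
have [q q_neq0 qx] := int_poly_vanishing x.
pose c := lead_coef q; exists c; first by rewrite lead_coef_eq0.
have [d size_q] : exists d, size q = d.+2.
  case sz_q : (size q) => [|[|d]]; last by exists d.
    by move/eqP: sz_q; rewrite size_poly_eq0 (negPf q_neq0).
  have /size_poly1P [b b_neq0 qE] : size q == 1 by rewrite sz_q.
  by move: qx; rewrite qE map_polyC rootC intr_numfield_eq0 (negPf b_neq0).
have sz_r : (size (\poly_(i < d.+1) (q`_i * c ^+ (d - i))%:~R : {poly E}) < d.+2)%N.
  by rewrite ltnS size_poly.
pose r : {poly E} := 'X^(d.+1) + \poly_(i < d.+1) (q`_i * c ^+ (d - i))%:~R.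
apply: (@Oint_root _ r).
- by rewrite monicE lead_coefDl ?lead_coefXn ?size_polyXn.
- move=> i; rewrite coefD coefXn coef_poly; apply: rpredD; first by rewrite rpred_nat.
  by case: ifP; rewrite ?Oint_int ?rpred0.
- have sz_qE : size (map_poly intr q : {poly E}) = d.+2.
    by rewrite size_map_poly_id0 // intr_numfield_eq0 lead_coef_eq0.
  move: qx; rewrite /root horner_coef sz_qE.
  rewrite big_ord_recr /= => /eqP /(congr1 (fun y => c%:~R ^+ d * y)).
  rewrite mulr0 mulrDr mulr_sumr => rel.
  rewrite /r hornerD hornerXn horner_poly addrC -[X in _ == X]rel; apply/eqP; congr (_ + _).
    apply: eq_bigr => i _; rewrite coef_map_id0 // rmorphM rmorphXn /= exprMn.
    have -> : c%:~R ^+ d = c%:~R ^+ (d - i) * c%:~R ^+ i :> E.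
      by rewrite -exprD subnK // -ltnS.
    by ring.
  rewrite coef_map_id0 // exprMn exprS.
  by rewrite (_ : q`_d.+1 = c) ?/c ?lead_coefE ?size_q //; ring.
Qed.

Lemma Oint_dvd_int (x : E) : x \in A -> x != 0 ->
  exists m : int, m != 0 /\ exists2 y, y \in A & m%:~R = x * y.
Proof.
move=> Ax x_neq0; have [m m_neq0 Amx] := Oint_scale x^-1.
by exists m; split=> //; exists (m%:~R * x^-1) => //; field.
Qed.

Section ModP.
Variable p : nat.
Hypothesis p_prime : prime p.

Let p_neq0 : p%:R != 0 :> E.
Proof. by rewrite -[p%:R]/(p%:Z%:~R) intr_numfield_eq0; case: p p_prime. Qed.

(* Linear independence in O_E / p. *)
Definition free_mod (l : seq E) := forall c : nat -> int,
  (\sum_(i < size l) (c i)%:~R * l`_i) / p%:R \in A ->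
  forall i, (i < size l)%N -> (p %| c i)%Z.

Lemma free_mod_size (l : seq E) : free_mod l -> (size l <= \dim {:E})%N.
Proof.
move=> l_free; suff l_indep : free (in_tuple l).
  by rewrite -(eqP l_indep) dimvS ?subvf.
apply/freeP => k k_rel.
have [D D_neq0 [c cE]] : exists2 D : int, D != 0 & exists c : nat -> int,
    forall i : 'I_(size l), D%:~R * k i = (c i)%:~R :> rat.
  exists (\prod_(i < size l) denq (k i)).
    by apply/prodf_neq0 => i _; exact: denq_neq0.
  have /fin_all_exists [c cE] : forall i : 'I_(size l), exists c : int,
      (\prod_(i < size l) denq (k i))%:~R * k i = c%:~R :> rat.
    move=> i; exists (\prod_(j < size l | j != i) denq (k j) * numq (k i)).
    rewrite (bigD1 i) //= !rmorphM /= numqE; ring.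
  exists (fun i => odflt 0 (omap c (insub i))) => i.
  by rewrite cE valK.
have c_rel : \sum_(i < size l) (c i)%:~R * l`_i = 0.
  transitivity (\sum_(i < size l) D%:~R *: (k i *: l`_i)).
    apply: eq_bigr => i _; rewrite scalerA cE -[_ *: _]mulr_algl; congr (_ * _).
    by rewrite -[RHS]/(in_alg E _) rmorph_int.
  by rewrite -scaler_sumr k_rel scaler0.
have div_c n : forall c : nat -> int, \sum_(i < size l) (c i)%:~R * l`_i = 0 ->
    forall i, (i < size l)%N -> ((p ^ n)%N %| c i)%Z.
  elim: n => [|n IHn] {k k_rel D D_neq0 cE c_rel}c c_rel i lt_i; first by rewrite dvd1z.
  have div_p j : (j < size l)%N -> (p %| c j)%Z.
    by apply: l_free; rewrite c_rel mul0r rpred0.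
  have := IHn (fun j => (c j %/ p)%Z) _ i lt_i.
  rewrite expnSr PoszM -{2}(divzK (div_p i lt_i)) => IH; apply: dvdz_mul => //; apply: IH.
  apply: (mulfI p_neq0); rewrite mulr0; apply: etrans c_rel.
  rewrite mulr_sumr; apply: eq_bigr => j _.
  by rewrite -[in RHS](divzK (div_p j (ltn_ord j))) intrM; ring.
move=> i; have /eqP := cE i.
suff -> : c i = 0 by rewrite mulf_eq0 intr_eq0 (negPf D_neq0) => /eqP.
apply/eqP; rewrite -absz_eq0; apply: contraT; rewrite -lt0n => c_gt0.
have := div_c `|c i|%N _ c_rel i (ltn_ord i); rewrite dvdzE /= => /(dvdn_leq c_gt0).
by rewrite leqNgt ltn_expl ?prime_gt1.
Qed.

Lemma Oint_mod_finite : exists2 l : seq E, {subset l <= A} &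
  forall x, x \in A -> exists2 y, y \in l & (x - y) / p%:R \in A.
Proof.
have [l [l_free l_int l_max]] : exists l, [/\ free_mod l, {subset l <= A} &
    forall x, x \in A -> ~ free_mod (x :: l)].
  apply: contrapT => no_l.
  suff [l l_free] : exists2 l, free_mod l /\ {subset l <= A} & size l = (\dim {:E}).+1.
    by have := free_mod_size l_free.1 => /[swap] ->; rewrite ltnn.
  elim: (_.+1) => [|d [l [l_free l_int] size_l]]; first by exists [::].
  apply: contrapT => no_x; apply: no_l; exists l; split=> // x Ax xl_free.
  apply: no_x; exists (x :: l); rewrite /= ?size_l //; split=> // y.
  by rewrite inE => /predU1P [-> // | /l_int].
exists [seq \sum_(i < size l) (f i)%:R * l`_i | f : {ffun 'I_(size l) -> 'I_p}].
  move=> _ /mapP [f _ ->]; apply: rpred_sum => i _.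
  by rewrite rpredM ?rpred_nat // l_int ?mem_nth.
move=> x Ax.
have /existsNP [c /not_implyP [c_rel c_ndiv]] := l_max x Ax.
move: c_rel; rewrite big_ord_recl.
rewrite -[X in (X + _) / _]/((c 0%N)%:~R * x).
rewrite -[X in (_ + X) / _]/(\sum_(i < size l) (c i.+1)%:~R * l`_i) => c_rel.
have cop0 : coprimez (c 0%N) p.
  rewrite coprimezE coprime_sym prime_coprime // -dvdzE.
  apply: contra_notN c_ndiv => p_c0.
  have c_rel' : (\sum_(i < size l) (c i.+1)%:~R * l`_i) / p%:R \in A.
    move: c_rel; rewrite mulrDl rpredDl //.
    rewrite -(divzK p_c0) intrM (_ : _ / _ = (c 0%N %/ p)%Z%:~R * x); last by field.
    by rewrite rpredM ?Oint_int.
  by case=> [|i] lt_i; [exact: p_c0 | exact: (l_free (fun j => c j.+1) c_rel' i lt_i)].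
have [u [w uw]] : exists u w : int, u * c 0%N + w * p = 1.
  by have /coprimezP [[u w] /= uw] := cop0; exists u, w.
have p_gt0 : (p : int) != 0 by case: p p_prime.
pose r i : int := (- (u * c i.+1) %% p)%Z.
have r_bd i : (`|r i| < p)%N.
  by have := ltz_mod (- (u * c i.+1)) p_gt0; have := modz_ge0 (- (u * c i.+1)) p_gt0;
    rewrite /r; lia.
exists (\sum_(i < size l) `|r i|%:R * l`_i).
  apply/mapP; exists [ffun i : 'I_(size l) => Ordinal (r_bd i)]; first by rewrite mem_enum.
  by apply: eq_bigr => i _; rewrite ffunE.
pose t i : int := (- (u * c i.+1) %/ p)%Z.
have rE (i : nat) : `|r i|%:R = - (u%:~R * (c i.+1)%:~R) - (t i)%:~R * p%:R :> E.
  rewrite -[LHS]/((`|r i|%N : int)%:~R) gez0_abs ?modz_ge0 //.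
  rewrite -[p%:R]/(p%:Z%:~R) -!intrM -!rmorphN -rmorphD /=; congr (_%:~R).
have -> : (x - \sum_(i < size l) `|r i|%:R * l`_i) / p%:R =
    u%:~R * (((c 0%N)%:~R * x + \sum_(i < size l) (c i.+1)%:~R * l`_i) / p%:R)
    + w%:~R * x + \sum_(i < size l) (t i)%:~R * l`_i.
  have -> : \sum_(i < size l) `|r i|%:R * l`_i =
      - u%:~R * \sum_(i < size l) (c i.+1)%:~R * l`_i
      - p%:R * \sum_(i < size l) (t i)%:~R * l`_i.
    rewrite !mulr_sumr -sumrB; apply: eq_bigr => i _; rewrite rE; ring.
  have xE : x = (u%:~R * (c 0%N)%:~R + w%:~R * p%:R) * x.
    by rewrite -[p%:R]/(p%:Z%:~R) -!intrM -rmorphD /= uw mul1r.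
  by rewrite [X in (X - _) / _]xE; field.
have Tint : \sum_(i < size l) (t i)%:~R * l`_i \in A.
  by apply: rpred_sum => i _; rewrite rpredM ?Oint_int // l_int ?mem_nth.
apply: rpredD Tint; apply: rpredD; last by rewrite rpredM ?Oint_int.
by apply: rpredM c_rel; exact: Oint_int.
Qed.

End ModP.
End NumberField.
(** * Ideals of rings of integers *)

Section IdealLemmas.
Variable E : fieldType.
Implicit Types I J T : set E.
Local Notation A := (Oint E).

Lemma ideal_Oint I x : is_ideal I -> I x -> x \in A.
Proof. by case=> sIA _ _ _ /sIA /OintP. Qed.

Lemma is_ideal0 I : is_ideal I -> I 0.
Proof. by case. Qed.

Lemma is_idealD I x y : is_ideal I -> I x -> I y -> I (x + y).
Proof. by case=> _ _ ID _; apply: ID. Qed.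

Lemma is_idealMl I x y : is_ideal I -> x \in A -> I y -> I (x * y).
Proof. by case=> _ _ _ IM /OintP; apply: IM. Qed.

Lemma is_idealMr I x y : is_ideal I -> I x -> y \in A -> I (x * y).
Proof. by move=> *; rewrite mulrC; apply: is_idealMl. Qed.

Lemma is_idealB I x y : is_ideal I -> I x -> I y -> I (x - y).
Proof.
move=> idI Ix Iy; apply: is_idealD => //.
by rewrite -mulN1r; apply: is_idealMl; rewrite ?rpredN ?rpred1.
Qed.

Lemma ringInt_ideal : is_ideal (@ringInt E).
Proof.
split=> // [|x y /OintP Ax /OintP Ay|x y /OintP Ax /OintP Ay]; apply/OintP.
- exact: rpred0.
- exact: rpredD.
- exact: rpredM.
Qed.

Lemma ideal_mul_mem I J x y : I x -> J y -> ideal_mul I J (x * y).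
Proof.
move=> Ix Jy; exists [:: (x, y)]; rewrite big_seq1; split=> // u.
by rewrite inE => /eqP ->.
Qed.

Lemma ideal_mul_sub I J T : T 0 -> (forall x y, T x -> T y -> T (x + y)) ->
  (forall x y, I x -> J y -> T (x * y)) -> ideal_mul I J `<=` T.
Proof.
move=> T0 TD TM _ [s [sIJ ->]]; rewrite big_seq.
by apply: (big_ind T) => // u /sIJ [Iu Ju]; apply: TM.
Qed.

Lemma ideal_mul_ideal I J : is_ideal I -> is_ideal J -> is_ideal (ideal_mul I J).
Proof.
move=> idI idJ; split.
- apply: ideal_mul_sub => [|x y|x y Ix Jy].
  + exact: (is_ideal0 ringInt_ideal).
  + exact: (is_idealD ringInt_ideal).
  + by apply/OintP/rpredM; [exact: (ideal_Oint idI) | exact: (ideal_Oint idJ)].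
- by exists [::]; rewrite big_nil.
- move=> _ _ [s [sIJ ->]] [t [tIJ ->]]; exists (s ++ t); rewrite big_cat; split=> // u.
  by rewrite mem_cat => /orP [/sIJ | /tIJ].
- move=> x _ /OintP Ax [s [sIJ ->]]; exists [seq (x * u.1, u.2) | u <- s].
  rewrite big_map mulr_sumr; split=> [_ /mapP [u /sIJ [Iu Ju] ->] /= |].
    by split=> //; apply: is_idealMl.
  by apply: eq_bigr => u _; rewrite mulrA.
Qed.

Lemma ideal_exp_ideal I n : is_ideal I -> is_ideal (ideal_exp I n).
Proof.
by move=> idI; elim: n => [|n IHn]; [exact: ringInt_ideal | exact: ideal_mul_ideal].
Qed.

Lemma ideal_exp_mem I x n : I x -> ideal_exp I n (x ^+ n).
Proof.
move=> Ix; elim: n => [|n IHn]; first by apply/OintP; rewrite expr0 rpred1.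
by rewrite exprS; apply: ideal_mul_mem.
Qed.

End IdealLemmas.

(* An ideal containing a power of P is determined by its localization at P. *)
Lemma ideal_localization (E F : fieldType) (f : {rmorphism E -> F}) (P : set E)
    (J : set F) (N : nat) (s : E) (x : F) :
  is_ideal P -> (forall z, z \in Oint E -> ~ P z -> exists2 y, y \in Oint E & P (1 - z * y)) ->
  is_ideal J -> (forall q, P q -> J (f q ^+ N)) ->
  s \in Oint E -> ~ P s -> x \in Oint F -> J (f s * x) -> J x.
Proof.
move=> P_ideal P_max idJ JP As nPs Fx Jsx.
have [y Ay P1] := P_max s As nPs.
have [z Az zE] : exists2 z, z \in Oint E & (1 - s * y) ^+ N = 1 - s * z.
  elim: (N) => [|n [z Az IHn]]; first by exists 0; rewrite ?rpred0 // expr0 mulr0 subr0.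
  exists (z + y - s * y * z); last by rewrite exprS IHn; ring.
  by rewrite rpredB ?rpredD ?rpredM.
have -> : x = f (1 - s * y) ^+ N * x + f z * (f s * x).
  by rewrite -rmorphXn zE rmorphB rmorph1 rmorphM; ring.
apply: is_idealD => //; first by apply: is_idealMr => //; apply: JP.
by apply: is_idealMl; rewrite ?Oint_rmorph.
Qed.

(** * Localization at a prime of a number field *)

Section PrimeLocalization.
Variables (E : fieldExtType rat) (p : nat) (P : set E).
Hypotheses (p_prime : prime p) (P_prime : is_prime P) (P_above : above_rat p P).
Local Notation A := (Oint E).

Let P_ideal : is_ideal P. Proof. by case: P_prime. Qed.
Let nP1 : ~ P 1. Proof. by case: P_prime. Qed.
Let PA x : P x -> x \in A. Proof. exact: ideal_Oint. Qed.

Let p_neq0 : p%:R != 0 :> E.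
Proof. by rewrite -[p%:R]/(p%:Z%:~R) intr_numfield_eq0; case: p p_prime. Qed.

Lemma above_ratE (z : int) : P z%:~R <-> (p %| z)%Z.
Proof. by have /(congr1 (fun S => S z)) /= -> := P_above. Qed.

Lemma prime_mul_notin x y : x \in A -> y \in A -> ~ P x -> ~ P y -> ~ P (x * y).
Proof. by move=> /OintP Ax /OintP Ay nPx nPy; case: P_prime => _ _ _ /[apply] -[]. Qed.

Lemma prime_exp_notin x n : x \in A -> ~ P x -> ~ P (x ^+ n).
Proof.
move=> Ax nPx; elim: n => [|n IHn]; rewrite ?expr0 // exprS.
by apply: prime_mul_notin; rewrite ?rpredX.
Qed.

Let Pp : P p%:R.
Proof. by apply/(above_ratE p). Qed.

Let P_div x : x / p%:R \in A -> P x.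
Proof. by move=> Ax; rewrite -(divfK p_neq0 x); apply: is_idealMl. Qed.

Lemma pigeonhole_mod (f : nat -> E) : (forall i, f i \in A) ->
  exists i j, (i < j)%N /\ (f i - f j) / p%:R \in A.
Proof.
move=> Af; have [l Al l_cov] := Oint_mod_finite E p_prime.
have {l_cov} [g g_l g_mod] : exists2 g : nat -> E, (forall i, g i \in l) &
    forall i, (f i - g i) / p%:R \in A.
  have /choice [g gP] : forall i, exists y, y \in l /\ (f i - y) / p%:R \in A.
    by move=> i; have [y] := l_cov _ (Af i); exists y.
  by exists g => i; case: (gP i).
have : ~~ uniq [seq g i | i <- iota 0 (size l).+1].
  apply: contraT => /negbNE /uniq_leq_size size_g.
  suff : (size [seq g i | i <- iota 0 (size l).+1] <= size l)%N.
    by rewrite size_map size_iota ltnn.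
  by apply: size_g => _ /mapP [i _ ->].
move=> /(uniqPn 0) [i [j [ij]]]; rewrite size_map size_iota => lt_j.
have lt_i := ltn_trans ij lt_j.
rewrite !(nth_map 0%N) ?size_iota // !nth_iota // !add0n => gij.
exists i, j; split=> //.
have -> : (f i - f j) / p%:R = (f i - g i) / p%:R - (f j - g j) / p%:R.
  by rewrite gij; field.
exact: rpredB.
Qed.

Lemma prime_maximal x : x \in A -> ~ P x -> exists2 y, y \in A & P (1 - x * y).
Proof.
move=> Ax nPx; have [|i [j [ij Aij]]] := @pigeonhole_mod (fun i => x ^+ i).
  by move=> i; rewrite rpredX.
exists (x ^+ (j - i).-1); first by rewrite rpredX.
rewrite -exprS prednK ?subn_gt0 //.
have xj : x ^+ j = x ^+ (j - i) * x ^+ i by rewrite -exprD subnK // ltnW.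
move: Aij; rewrite xj => /P_div Px.
apply: contrapT => nPy.
have : ~ P (x ^+ i * (1 - x ^+ (j - i))).
  apply: prime_mul_notin => //; rewrite ?rpredX ?rpredB ?rpred1 ?rpredX //.
  exact: prime_exp_notin.
by rewrite mulrBr mulr1 mulrC.
Qed.

Let dvd_loc x := exists2 s, s \in A /\ ~ P s & s * x / p%:R \in A.

Let dvd_locM x y : y \in A -> dvd_loc x -> dvd_loc (x * y).
Proof.
move=> Ay [s nPs Asx]; exists s => //.
have -> : s * (x * y) / p%:R = s * x / p%:R * y by field.
exact: rpredM.
Qed.

Let dvd_loc_nil y : P y -> exists i, dvd_loc (y ^+ i).
Proof.
move=> Py; have [|i [j [ij Aij]]] := @pigeonhole_mod (fun i => y ^+ i).
  by move=> i; rewrite rpredX // PA.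
exists i, (1 - y ^+ (j - i)).
  split=> [|P1y]; first by rewrite rpredB ?rpred1 ?rpredX ?PA.
  apply: nP1; rewrite -(subrK (y ^+ (j - i)) 1); apply: is_idealD => //.
  case: (j - i)%N ij (subn_gt0 i j) => [|n] ij; first by rewrite ij.
  by rewrite exprS => _; apply: is_idealMr; rewrite ?rpredX ?PA.
by rewrite mulrBl mul1r -exprD subnK // ltnW.
Qed.

(* Multiplies 1 by powers of the elements of l, each time by the largest power
   that does not yet make the product divisible by p. *)
Let socle_elt (l : seq E) : (forall y, y \in l -> P y) ->
  exists2 b, b \in A /\ ~ dvd_loc b & forall y, y \in l -> dvd_loc (b * y).
Proof.
elim: l => [|y l IHl] Pl.
  exists 1; rewrite ?rpred1 //; split=> // -[s [As nPs]].
  by rewrite mulr1 => /P_div.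
have [z lz|b [Ab ndvd_b] b_l] := IHl; first by apply: Pl; rewrite inE lz orbT.
have Py : P y by apply: Pl; rewrite inE eqxx.
have ex_i : exists i, `[< dvd_loc (b * y ^+ i) >].
  have [i y_i] := dvd_loc_nil Py; exists i; apply/asboolP.
  by rewrite mulrC; apply: dvd_locM.
case: (ex_minnP ex_i) => -[|i] /asboolP dvd_i i_min; first by rewrite mulr1 in dvd_i.
exists (b * y ^+ i).
  split=> [|dvd_i']; first by rewrite rpredM ?rpredX ?(PA Py).
  by have := i_min i (asboolT dvd_i'); rewrite ltnn.
move=> z; rewrite inE => /predU1P [-> | lz]; first by rewrite -mulrA -exprSr.
by rewrite mulrAC; apply: dvd_locM (b_l z lz); rewrite rpredX // PA.
Qed.

(* If x P were contained in P, the powers of x would lie in O/p, and by finiteness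
   two of them would be congruent modulo O, making x integral. *)
Lemma prime_conductor : exists x, [/\ x \notin A, (forall y, P y -> x * y \in A)
  & exists s, x * s \in A /\ ~ P (x * s) /\ P s].
Proof.
have [l Al l_cov] := Oint_mod_finite E p_prime.
have [y|b [Ab ndvd_b] b_l] := @socle_elt [seq y <- l | `[< P y >]].
  by rewrite mem_filter => /andP [/asboolP].
have [s [As nPs] s_l] : exists2 s, s \in A /\ ~ P s &
    forall y, y \in [seq y <- l | `[< P y >]] -> s * (b * y) / p%:R \in A.
  elim: [seq y <- l | _] b_l => [|y l' IHl'] b_l.
    by exists 1; rewrite ?rpred1.
  have [z lz|s [As nPs] s_l] := IHl'; first by apply: b_l; rewrite inE lz orbT.
  have [|t [At nPt] t_y] := b_l y; first by rewrite inE eqxx.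
  exists (s * t); first by split; [rewrite rpredM | exact: prime_mul_notin].
  move=> z; rewrite inE => /predU1P [-> | lz].
    have -> : s * t * (b * y) / p%:R = s * (t * (b * y) / p%:R) by field.
    exact: rpredM.
  have -> : s * t * (b * z) / p%:R = t * (s * (b * z) / p%:R) by field.
  by rewrite rpredM ?s_l.
pose x := s * b / p%:R.
have xP y : P y -> x * y \in A.
  move=> Py; have [y0 ly0 Ay0] := l_cov y (PA Py).
  have Py0 : P y0.
    rewrite -(subKr y y0); apply: is_idealB => //; exact: P_div.
  have -> : x * y = s * (b * y0) / p%:R + s * b * ((y - y0) / p%:R) by rewrite /x; field.
  apply: rpredD; last by apply: rpredM Ay0; apply: rpredM.
  by apply: s_l; rewrite mem_filter ly0 andbT; apply/asboolP.
have nAx : x \notin A.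
  by apply/negP => Ax; apply: ndvd_b; exists s.
exists x; split=> //; apply: contrapT => no_y.
have xPP y : P y -> P (x * y).
  by move=> Py; apply: contrapT => nPxy; apply: no_y; exists y; split; first exact: xP.
have Pxp i : P (x ^+ i * p%:R).
  by elim: i => [|i IHi]; rewrite ?mul1r // exprS -mulrA; apply: xPP.
have [|i [j [ij Aij]]] := @pigeonhole_mod (fun i => x ^+ i * p%:R).
  by move=> i; apply: PA.
move: Aij; rewrite -mulrBl mulfK // => Aij; move/negP: nAx; apply.
apply: (@Oint_root _ ('X^j + ((x ^+ i - x ^+ j)%:P - 'X^i))).
- rewrite monicE lead_coefDl ?lead_coefXn // size_polyXn ltnS.
  rewrite (leq_trans (size_polyD _ _)) // size_polyN size_polyXn geq_max ij andbT.
  by rewrite size_polyC (leq_trans (leq_b1 _)) // (leq_ltn_trans _ ij).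
- by move=> k; rewrite !coefE !(rpredD, rpredN) ?rpred_nat //; case: ifP; rewrite ?rpred0.
- by rewrite /root !(hornerD, hornerN, hornerC, hornerXn); apply/eqP; ring.
Qed.

Lemma prime_uniformizer : exists y t, [/\ P y, t \in A, ~ P t
  & forall z, P z -> exists2 z', z' \in A & t * z = z' * y].
Proof.
have [x [nAx xP [s [Axs [nPxs Ps]]]]] := prime_conductor.
exists s, (x * s); split=> // z Pz; exists (x * z); first exact: xP.
by rewrite mulrAC.
Qed.

Section Valuation.
Variables (y t : E).
Hypotheses (Py : P y) (At : t \in A) (nPt : ~ P t).
Hypothesis y_gen : forall z, P z -> exists2 z', z' \in A & t * z = z' * y.

Lemma uniformizer_neq0 : y != 0.
Proof.
apply/eqP => y0; have [z' _] := y_gen Pp.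
by rewrite y0 mulr0 => /eqP; rewrite mulf_eq0 (negPf p_neq0) orbF => /eqP t0;
  case: nPt; rewrite t0; apply: is_ideal0.
Qed.
Let y_neq0 := uniformizer_neq0.
Let Ay : y \in A := PA Py.

Lemma divisible_int (N : nat) (m : int) (s : E) : s \in A -> ~ P s ->
  s * m%:~R / p%:R ^+ N \in A -> ((p ^ N)%N %| m)%Z.
Proof.
move=> As nPs; elim: N m => [|N IHN] m Asm; first by rewrite dvd1z.
have pm : (p %| m)%Z.
  apply/above_ratE; apply: contrapT => nPm.
  apply: (@prime_mul_notin s m%:~R As _ nPs nPm); first exact: Oint_int.
  rewrite (_ : s * m%:~R = p%:R * (p%:R ^+ N * (s * m%:~R / p%:R ^+ N.+1))).
    by apply: is_idealMr => //; apply: rpredM Asm; rewrite rpredX ?rpred_nat.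
  by rewrite exprS; field; rewrite expf_neq0 ?p_neq0.
rewrite -(divzK pm) expnSr PoszM; apply: dvdz_mul => //; apply: IHN.
move: Asm; rewrite -{1}(divzK pm) intrM exprS; congr (_ \in A).
by rewrite -[p%:Z%:~R]/(p%:R); field; rewrite expf_neq0 ?p_neq0.
Qed.

Lemma uniformizer_pow_bounded x : x \in A -> x != 0 ->
  exists N, forall s, s \in A -> ~ P s -> s * x / y ^+ N \notin A.
Proof.
move=> Ax x_neq0; have [m [m_neq0 [x' Ax' mE]]] := Oint_dvd_int Ax x_neq0.
have [i [s0 [As0 nPs0] As0y]] := dvd_loc_nil Py.
pose N := `|m|%N; exists (i * N)%N => s As nPs; apply/negP => Asx.
have : ((p ^ N)%N %| m)%Z.
  apply: (@divisible_int _ _ (s * s0 ^+ N)).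
  - by rewrite rpredM ?rpredX.
  - by apply: prime_mul_notin; rewrite ?rpredX //; apply: prime_exp_notin.
  - have -> : s * s0 ^+ N * m%:~R / p%:R ^+ N =
      s * x / y ^+ (i * N) * x' * (s0 * y ^+ i / p%:R) ^+ N.
      rewrite mE exprM !exprMn exprVn; field.
      by rewrite !expf_neq0 ?y_neq0 ?p_neq0.
    by apply: rpredM; [exact: rpredM | exact: rpredX].
rewrite dvdzE /= => /dvdn_leq; rewrite lt0n absz_eq0 m_neq0 => /(_ isT).
by rewrite leqNgt ltn_expl ?prime_gt1.
Qed.

(* x = y^e times a unit of the localization at P. *)
Definition val_spec (x : E) (e : int) :=
  exists s r, [/\ s \in A, r \in A, ~ P s, ~ P r & s * x = y ^ e * r].

Lemma val_spec_Oint x : x \in A -> x != 0 -> exists n : nat, val_spec x n.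
Proof.
move=> Ax x_neq0; have [N bd_N] := uniformizer_pow_bounded Ax x_neq0.
pose bad n := `[< forall s, s \in A -> ~ P s -> s * x / y ^+ n \notin A >].
have ex_bad : exists n, bad n by exists N; apply/asboolP.
case: (ex_minnP ex_bad) => -[|n] /asboolP bad_n n_min.
  by have := bad_n 1 (rpred1 _) nP1; rewrite expr0 divr1 mul1r Ax.
have : ~~ bad n by apply/negP => /n_min; rewrite ltnn.
move=> /asboolPn /existsNP [s /not_implyP [As /not_implyP [nPs /negP]]].
rewrite negbK => Asx; exists n, s, (s * x / y ^+ n); split=> //.
- move=> /y_gen [z' Az' tE].
  have := bad_n (t * s); rewrite rpredM // => /(_ isT) /(_ (prime_mul_notin At As nPt nPs)).
  suff -> : t * s * x / y ^+ n.+1 = z' by rewrite Az'.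
  apply: (mulIf y_neq0); rewrite -tE exprS; field.
  by rewrite expf_neq0 ?y_neq0.
- by rewrite -exprnP [RHS]mulrC divfK ?expf_neq0 ?y_neq0.
Qed.

Lemma val_spec_neq0 x e : val_spec x e -> x != 0.
Proof.
move=> [s [r [As Ar nPs nPr sE]]]; apply/eqP => x0; move: sE; rewrite x0 mulr0 => /esym/eqP.
rewrite mulf_eq0 expfz_eq0 (negPf y_neq0) andbF /= => /eqP r0.
by apply: nPr; rewrite r0; apply: is_ideal0.
Qed.

Let y_pow_lt e e' c : c \in A -> e < e' -> exists2 d, P d & y ^ e' * c = y ^ e * d.
Proof.
move=> Ac lt_e; exists (y ^+ `|e' - e|%N * c).
  apply: is_idealMr => //; have : (0 < `|e' - e|)%N by rewrite absz_gt0 subr_eq0 gt_eqF.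
  case: `|e' - e|%N => // n _; rewrite exprS; apply: is_idealMr => //.
  by rewrite rpredX ?PA.
rewrite mulrA exprnP gez0_abs ?subr_ge0 1?ltW // -expfzDr ?y_neq0 //.
by congr (_ ^ _ * _); lia.
Qed.

Let y_pow_cancel e e' c d : c \in A -> ~ P c -> d \in A -> y ^ e * c = y ^ e' * d -> e' <= e.
Proof.
move=> Ac nPc Ad eq_cd; rewrite leNgt; apply/negP => lt_e.
have [d' Pd' dE] := y_pow_lt Ad lt_e.
apply: nPc; suff -> : c = d' by [].
by apply: (mulfI (expfz_neq0 e y_neq0)); rewrite eq_cd.
Qed.

Lemma val_spec_uniq x e e' : val_spec x e -> val_spec x e' -> e = e'.
Proof.
move=> [s [r [As Ar nPs nPr sE]]] [s' [r' [As' Ar' nPs' nPr' sE']]].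
have rel : y ^ e * (s' * r) = y ^ e' * (s * r').
  by rewrite mulrCA -sE [RHS]mulrCA -sE'; ring.
apply: le_anti; apply/andP; split.
- by apply: (y_pow_cancel _ _ _ (esym rel)); rewrite ?rpredM //; apply: prime_mul_notin.
- by apply: (y_pow_cancel _ _ _ rel); rewrite ?rpredM //; apply: prime_mul_notin.
Qed.

Lemma val_specM x x' e e' : val_spec x e -> val_spec x' e' -> val_spec (x * x') (e + e').
Proof.
move=> [s [r [As Ar nPs nPr sE]]] [s' [r' [As' Ar' nPs' nPr' sE']]].
exists (s * s'), (r * r'); split; rewrite ?rpredM //; try exact: prime_mul_notin.
by rewrite mulrACA sE sE' expfzDr ?y_neq0 //; ring.
Qed.

Lemma val_specV x e : val_spec x e -> val_spec x^-1 (- e).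
Proof.
move=> vx; have x_neq0 := val_spec_neq0 vx.
move: vx => [s [r [As Ar nPs nPr sE]]]; exists r, s; split=> //.
have y_e := expfz_neq0 e y_neq0.
have -> : r = s * x / y ^ e by rewrite sE mulrAC divff // mul1r.
rewrite -invr_expz; move: (y ^ e) y_e => c c_neq0; field.
by rewrite x_neq0 c_neq0.
Qed.

Lemma val_spec_exists x : x != 0 -> exists e, val_spec x e.
Proof.
move=> x_neq0; have [m m_neq0 Amx] := Oint_scale x.
have m_neq0' : m%:~R != 0 :> E by rewrite intr_numfield_eq0.
have [n1 v1] := val_spec_Oint Amx (mulf_neq0 m_neq0' x_neq0).
have [n2 v2] := val_spec_Oint (Oint_int _ m) m_neq0'.
exists (n1%:Z - n2%:Z); have -> : x = m%:~R * x * m%:~R^-1 by field.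
by apply: val_specM => //; apply: val_specV.
Qed.

Lemma val_spec_ge x e : val_spec x e ->
  (0 <= e <-> exists a s, [/\ a \in A, s \in A, ~ P s & x = a / s]).
Proof.
move=> [s [r [As Ar nPs nPr sE]]].
have nz c : ~ P c -> c != 0.
  by move=> nPc; apply/eqP => c0; apply: nPc; rewrite c0; apply: is_ideal0.
split=> [e_ge0 | [a [s' [Aa As' nPs' xE]]]].
  exists (y ^ e * r), s; split=> //.
    by case: (e) e_ge0 => // n _; rewrite -exprnP rpredM ?rpredX.
  by rewrite -sE mulrC mulKf ?nz.
apply: (@y_pow_cancel e 0 (s' * r) (a * s)); rewrite ?rpredM //.
  exact: prime_mul_notin.
by rewrite expr0z mul1r mulrCA -sE xE; field; apply: nz.
Qed.

Lemma val_spec_prime x e : x \in A -> val_spec x e -> (P x <-> 1 <= e).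
Proof.
move=> Ax [s [r [As Ar nPs nPr sE]]]; split=> [Px | e_ge1].
  have [z' Az' tE] := y_gen Px.
  apply: (@y_pow_cancel e 1 (t * r) (s * z')); rewrite ?rpredM //.
    exact: prime_mul_notin.
  by rewrite mulrCA -sE expr1z mulrCA tE; ring.
apply: contrapT => nPx; apply: (prime_mul_notin As Ax nPs nPx).
have [d Pd dE] := @y_pow_lt 0 e r Ar e_ge1.
by rewrite sE dE expr0z mul1r.
Qed.

Lemma val_specD x x' e e' e'' : val_spec x e -> val_spec x' e' -> val_spec (x + x') e'' ->
  Num.min e e' <= e''.
Proof.
wlog le_e : x x' e e' / e <= e'.
  move=> IH vx vx'; case/orP: (le_total e e') => le_e; first exact: IH.
  by rewrite addrC minC; apply: IH.
move=> [s [r [As Ar nPs nPr sE]]] [s' [r' [As' Ar' nPs' nPr' sE']]].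
move=> [s'' [r'' [As'' Ar'' nPs'' nPr'' sE'']]]; rewrite (min_idPl le_e).
apply: (@y_pow_cancel e'' e (s * s' * r'') (s'' * (s' * r + s * (y ^+ `|e' - e|%N * r')))).
- by rewrite !rpredM.
- by do 2?apply: prime_mul_notin; rewrite ?rpredM.
- by rewrite !(rpredM, rpredD, rpredX).
- have -> : y ^ e * (s'' * (s' * r + s * (y ^+ `|e' - e|%N * r'))) =
    s'' * (s' * (y ^ e * r) + s * (y ^ e * y ^+ `|e' - e|%N * r')) by ring.
  rewrite exprnP gez0_abs ?subr_ge0 // -expfzDr ?y_neq0 // [e + _]addrC subrK.
  by rewrite -sE -sE' mulrCA -sE''; ring.
Qed.

Lemma exact_powP x n : exact_pow P x n <-> x \in A /\ val_spec x n.
Proof.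
have pow_mem m c : c \in A -> ideal_exp P m (y ^ m%:Z * c).
  by move=> Ac; apply: is_idealMr => //; [exact: ideal_exp_ideal | exact: ideal_exp_mem].
have pow_spec m z : ideal_exp P m z ->
    exists s c, [/\ s \in A, c \in A, ~ P s & s * z = y ^ m%:Z * c].
  move=> Pz; exists (t ^+ m).
  suff [c Ac cE] : exists2 c, c \in A & t ^+ m * z = y ^ m%:Z * c.
    by exists c; split; rewrite ?rpredX //; apply: prime_exp_notin.
  elim: m z Pz => [z /OintP Az|m IHm].
    by exists z; rewrite ?expr0 ?expr0z.
  apply: ideal_mul_sub => [|u v [c Ac cE] [d Ad dE]|u v Pu /IHm [d Ad dE]].
  - by exists 0; rewrite ?rpred0 ?mulr0.
  - by exists (c + d); rewrite ?rpredD // !mulrDr cE dE.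
  - have [u' Au' uE] := y_gen Pu; exists (u' * d); first by rewrite rpredM.
    by rewrite exprS mulrACA uE dE -!exprnP exprS; ring.
have Poi m q : P q -> ideal_exp P m (q ^+ m) by apply: ideal_exp_mem.
have loc m s z : s \in A -> ~ P s -> z \in A -> ideal_exp P m (s * z) -> ideal_exp P m z.
  apply: (@ideal_localization E E idfun P _ m) => //; last exact: Poi.
  - by move=> u; apply: prime_maximal.
  - exact: ideal_exp_ideal.
split=> [[Px nPx] | [Ax [s [r [As Ar nPs nPr sE]]]]].
  have Ax : x \in A by apply: ideal_Oint Px; apply: ideal_exp_ideal.
  split=> //; have [s [c [As Ac nPs sE]]] := pow_spec _ _ Px.
  exists s, c; split=> // Pc; apply: nPx; apply: (loc _ s) => //.
  rewrite sE mulrC; apply: ideal_mul_mem => //.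
  by rewrite -[_ ^ _]mulr1; apply: pow_mem; rewrite rpred1.
split; first by apply: (loc _ s) => //; rewrite sE; apply: pow_mem.
move=> /pow_spec [s' [c [As' Ac nPs' sE']]].
suff : (n.+1%:Z <= n%:Z) by rewrite lez_nat ltnn.
apply: (@y_pow_cancel _ _ (s' * r) (s * c)); rewrite ?rpredM //.
  exact: prime_mul_notin.
by rewrite mulrCA -sE [RHS]mulrCA -sE'; ring.
Qed.

Lemma has_valP x e : has_val P x e <-> val_spec x e.
Proof.
split=> [[u [v [i [j [/exact_powP [_ vu] /exact_powP [_ vv] -> ->]]]]] | ].
  by apply: val_specM => //; apply: val_specV.
move=> [s [r [As Ar nPs nPr sE]]].
have s_neq0 : s != 0 by apply/eqP => s0; apply: nPs; rewrite s0; apply: is_ideal0.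
have epow c n : c \in A -> ~ P c -> exact_pow P (y ^+ n * c) n.
  move=> Ac nPc; apply/exact_powP; split; first by rewrite rpredM ?rpredX.
  by exists 1, c; split; rewrite ?rpred1 ?mul1r.
case: e sE => n sE.
  exists (y ^+ n * r), (y ^+ 0 * s), n, 0%N; split; rewrite ?subr0 //; try exact: epow.
  by rewrite exprnP -sE; field.
exists (y ^+ 0 * r), (y ^+ n.+1 * s), 0%N, n.+1; split; rewrite ?sub0r //; try exact: epow.
  apply: (mulfI s_neq0); rewrite sE NegzE -invr_expz -exprnP; field.
  by rewrite s_neq0 expf_neq0 ?y_neq0.
Qed.

Lemma vP_spec x : x != 0 -> val_spec x (vP P x).
Proof.
move=> /val_spec_exists [e /has_valP ve].
by apply/has_valP; rewrite /vP; apply: (xgetPex 0); exists e.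
Qed.

End Valuation.

Lemma vP_valuation : is_valuation (vP P).
Proof.
have [y [t [Py At nPt y_gen]]] := prime_uniformizer.
have spec := vP_spec Py At nPt y_gen.
split=> [x z x_neq0 z_neq0 | x z x_neq0 z_neq0 xz_neq0].
  apply: (val_spec_uniq Py At nPt y_gen (spec _ (mulf_neq0 x_neq0 z_neq0))).
  by apply: (val_specM nPt y_gen); apply: spec.
by apply: (val_specD Py At nPt y_gen (spec _ x_neq0) (spec _ z_neq0)); apply: spec.
Qed.

Lemma vP_ge0 x : x != 0 ->
  (0 <= vP P x <-> exists a s, [/\ a \in A, s \in A, ~ P s & x = a / s]).
Proof.
have [y [t [Py At nPt y_gen]]] := prime_uniformizer.
have spec := vP_spec Py At nPt y_gen.
by move=> x_neq0; apply: (val_spec_ge Py At nPt y_gen); apply: spec.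
Qed.

Lemma vP_ge1 x : x \in A -> x != 0 -> (P x <-> 1 <= vP P x).
Proof.
have [y [t [Py At nPt y_gen]]] := prime_uniformizer.
have spec := vP_spec Py At nPt y_gen.
by move=> Ax x_neq0; apply: (val_spec_prime Py At nPt y_gen) => //; apply: spec.
Qed.

Lemma vP_neq0 x : vP P x != 0 -> x != 0.
Proof.
have [y [t [Py At nPt y_gen]]] := prime_uniformizer.
apply: contra_neqN => /eqP ->; rewrite /vP; case: xgetP => // e _.
by move=> /(has_valP Py At nPt y_gen) /(val_spec_neq0 nPt y_gen); rewrite eqxx.
Qed.

End PrimeLocalization.

Lemma dvdp_exp_separable (k : fieldType) (q f : {poly k}) d :
  separable_poly q -> q %| f ^+ d -> q %| f.
Proof.
move=> sep_q q_fd; pose h := q %/ gcdp q f.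
have qE : q = h * gcdp q f by rewrite divpK ?dvdp_gcdl.
have h_q : h %| q by rewrite [X in _ %| X]qE dvdp_mulr.
have cop_hf : coprimep h f.
  have cop : coprimep h (gcdp q f) by apply: (separable_coprime sep_q); rewrite -qE.
  apply/coprimepP => c c_h c_f; move/coprimepP: cop; apply => //.
  by rewrite dvdp_gcd c_f (dvdp_trans c_h).
have : h %| 1.
  rewrite -(Gauss_dvdpr 1 (coprimep_expr d cop_hf)) mulr1.
  exact: dvdp_trans h_q q_fd.
rewrite dvdp1 => /size_poly1P [c c_neq0 hE].
by rewrite qE hE mul_polyC dvdpZl // dvdp_gcdr.
Qed.

Lemma separable_Xn_sub_const (k : fieldType) n (c : k) :
  n%:R != 0 :> k -> c != 0 -> separable_poly ('X^n - c%:P).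
Proof.
move=> n_neq0 c_neq0; rewrite separable_poly.unlock derivB derivC subr0 derivXn.
case: n n_neq0 => [|n] n_neq0; first by rewrite eqxx in n_neq0.
apply/Bezout_eq1_coprimepP; exists ((- c^-1)%:P, 'X * ((n.+1%:R * c)^-1)%:P) => /=.
have -> : 'X^n *+ n.+1 = 'X^n * n.+1%:R%:P :> {poly k} by rewrite polyC_natr mulr_natr.
rewrite exprS polyCN invfM polyCM.
transitivity ((c^-1)%:P * c%:P
  + 'X * 'X^n * (c^-1)%:P * ((n.+1%:R)^-1%:P * n.+1%:R%:P - 1) : {poly k}).
  by ring.
by rewrite -!polyCM !mulVf // subrr mulr0 addr0.
Qed.

Lemma sum_multiples (V : nmodType) (e : nat) (G : nat -> V) i :
  (0 < e)%N -> (forall l, ~~ (e %| l)%N -> G l = 0) ->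
  \sum_(l < (e * i).+1) G l = \sum_(j < i.+1) G (e * j)%N.
Proof.
move=> e_gt0 G0; elim: i => [|i IHi]; first by rewrite muln0 !big_ord1 muln0.
rewrite [RHS]big_ord_recr -IHi /= -!(big_mkord xpredT G).
have le1 : ((e * i).+1 <= e * i.+1)%N by rewrite mulnS -[X in (X <= _)%N]add1n leq_add2r.
rewrite (big_cat_nat _ (leqW le1)) //=; congr (_ + _).
rewrite big_nat_recr //= big_nat big1 ?add0r // => l /andP [l_gt l_lt].
apply: G0; apply/negP => /dvdnP [c lE]; move: l_gt l_lt.
by rewrite lE [(c * e)%N]mulnC !ltn_mul2l e_gt0 /= => lt_ic; rewrite ltnS leqNgt lt_ic.
Qed.

(** * Kummer extensions of degree prime to the residue characteristic *)

Section KummerTame.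
Variables (L M : fieldType) (iota : {rmorphism L -> M}) (v : L -> int).
Variables (P : set L) (k : fieldType) (red : L -> k) (pi a : L) (gam : M).
Variables g e v1 : nat.
Local Notation A := (Oint L).
Local Notation B := (Oint M).
Hypotheses (P_ideal : is_ideal P) (nP1 : ~ P 1).
Hypothesis P_prime_mul : forall s s', s \in A -> s' \in A -> ~ P s -> ~ P s' -> ~ P (s * s').
Hypothesis P_max : forall x, x \in A -> ~ P x -> exists2 y, y \in A & P (1 - x * y).
Hypothesis v_val : is_valuation v.
Hypothesis v_ge0 : forall x, x != 0 ->
  (0 <= v x <-> exists b s, [/\ b \in A, s \in A, ~ P s & x = b / s]).
Hypothesis v_ge1 : forall x, x \in A -> x != 0 -> (P x <-> 1 <= v x).
Hypothesis red_residue : is_residue_field P red.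
Hypotheses (pi_neq0 : pi != 0) (v_pi : v pi = 1).
Hypotheses (a_neq0 : a != 0) (v_a : v a = (g * v1)%N).
Hypotheses (g_gt0 : (0 < g)%N) (e_gt0 : (0 < e)%N) (g_neq0 : g%:R != 0 :> k).
Hypothesis cop_e_v1 : coprime e v1.
Hypothesis gam_exp : gam ^+ (g * e) = iota a.
Hypothesis gam_gen : forall x, exists f, (map_poly iota f).[gam] = x.
Hypothesis gam_min : forall f, (map_poly iota f).[gam] = 0 -> 'X^(g * e) - a%:P %| f.

(* Values are scaled by e, so that gam has the integral value v1. *)
Definition vge (w : int) (c : L) := (c == 0) || (w <= e%:Z * v c).

Lemma v1_eq0 : v 1 = 0.
Proof.
have [vM _] := v_val; have := vM 1 1 (oner_neq0 _) (oner_neq0 _).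
by rewrite mulr1; lia.
Qed.

Lemma vV x : x != 0 -> v x^-1 = - v x.
Proof.
move=> x_neq0; have [vM _] := v_val; have := vM x x^-1 x_neq0 (invr_neq0 x_neq0).
by rewrite divff // v1_eq0; lia.
Qed.

Lemma vX x n : x != 0 -> v (x ^+ n) = n%:Z * v x.
Proof.
have [vM _] := v_val; move=> x_neq0; elim: n => [|n IHn]; first by rewrite expr0 v1_eq0 mul0r.
by rewrite exprS vM ?expf_neq0 // IHn; lia.
Qed.

Lemma vXz x (n : int) : x != 0 -> v (x ^ n) = n * v x.
Proof.
move=> x_neq0; case: n => n; first by rewrite -exprnP vX.
by rewrite NegzE -invr_expz vV ?expfz_neq0 // -exprnP vX // mulNr.
Qed.

Lemma vge_le w w' c : w' <= w -> vge w c -> vge w' c.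
Proof. by move=> le_w /predU1P [-> | vc]; rewrite /vge ?eqxx // (le_trans le_w vc) orbT. Qed.

Lemma vge0 w : vge w 0. Proof. by rewrite /vge eqxx. Qed.

Lemma vgeD w c d : vge w c -> vge w d -> vge w (c + d).
Proof.
have [_ vD] := v_val.
have [->|c_neq0] := eqVneq c 0; first by rewrite add0r.
have [->|d_neq0] := eqVneq d 0; first by rewrite addr0.
rewrite /vge (negPf c_neq0) (negPf d_neq0) /= => vc vd.
have [//|cd_neq0 /=] := eqVneq (c + d) 0.
have := vD _ _ c_neq0 d_neq0 cd_neq0; rewrite ge_min => /orP [le_v|le_v].
- by apply: le_trans vc _; rewrite ler_wpM2l.
- by apply: le_trans vd _; rewrite ler_wpM2l.
Qed.

Lemma vgeM w w' c d : vge w c -> vge w' d -> vge (w + w') (c * d).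
Proof.
have [vM _] := v_val.
have [->|c_neq0] := eqVneq c 0; first by rewrite mul0r => *; exact: vge0.
have [->|d_neq0] := eqVneq d 0; first by rewrite mulr0 => *; exact: vge0.
rewrite /vge (negPf c_neq0) (negPf d_neq0) mulf_eq0 (negPf c_neq0) (negPf d_neq0) /=.
by move=> vc vd; rewrite vM // mulrDr lerD.
Qed.

Lemma vge_sum w I (s : seq I) (F : I -> L) :
  (forall i, vge w (F i)) -> vge w (\sum_(i <- s) F i).
Proof. by move=> vF; apply: (big_ind (vge w)); [exact: vge0 | exact: vgeD | ]. Qed.

Lemma vge_pi n : vge (e * n)%N (pi ^+ n).
Proof. by rewrite /vge vX // v_pi mulr1 PoszM lexx orbT. Qed.

Lemma vge_a : vge (g * e * v1)%N a.
Proof. by rewrite /vge v_a orbC; apply/orP; left; lia. Qed.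

Lemma vge_frac c : vge 0 c <-> exists b s, [/\ b \in A, s \in A, ~ P s & c = b / s].
Proof.
have [->|c_neq0] := eqVneq c 0.
  split=> _; last exact: vge0.
  by exists 0, 1; rewrite ?rpred0 ?rpred1 ?mul0r.
rewrite -v_ge0 // /vge (negPf c_neq0) /= pmulr_rge0 //.
Qed.

Lemma prime_notin_neq0 s : ~ P s -> s != 0.
Proof. by move=> nPs; apply/eqP => s0; apply: nPs; rewrite s0; apply: is_ideal0. Qed.

Lemma red_Oint_eq0 s : s \in A -> (red s = 0 <-> P s).
Proof. by move=> /OintP As; case: red_residue => _ _ red0 _ _; apply: red0. Qed.

Lemma red_neq0 s : s \in A -> ~ P s -> red s != 0.
Proof. by move=> As nPs; apply/eqP => /(red_Oint_eq0 As). Qed.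

Lemma red_frac b s : b \in A -> s \in A -> ~ P s -> red (b / s) = red b / red s.
Proof. by move=> /OintP Ab /OintP As nPs; case: red_residue => _ _ _ _; apply. Qed.

Lemma red_Oint b c : b \in A -> c \in A ->
  red (b + c) = red b + red c /\ red (b * c) = red b * red c.
Proof. by move=> /OintP Ab /OintP Ac; case: red_residue => _ + _ _ _; apply. Qed.

Lemma red1 : red 1 = 1. Proof. by case: red_residue. Qed.

Lemma red0 : red 0 = 0.
Proof. by apply/(red_Oint_eq0 (rpred0 _)); apply: is_ideal0. Qed.

Lemma redD c d : vge 0 c -> vge 0 d -> red (c + d) = red c + red d.
Proof.
move=> /vge_frac [b [s [Ab As nPs ->]]] /vge_frac [b' [s' [Ab' As' nPs' ->]]].
have [s_neq0 s'_neq0] := (prime_notin_neq0 nPs, prime_notin_neq0 nPs').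
have [rs_neq0 rs'_neq0] := (red_neq0 As nPs, red_neq0 As' nPs').
have -> : b / s + b' / s' = (b * s' + b' * s) / (s * s').
  by field; rewrite s_neq0 s'_neq0.
rewrite !red_frac ?rpredD ?rpredM //; last exact: P_prime_mul.
have [_ ->] := red_Oint As As'.
have [||-> _] := @red_Oint (b * s') (b' * s); [exact: rpredM | exact: rpredM | ].
have [_ ->] := red_Oint Ab As'; have [_ ->] := red_Oint Ab' As.
by field; rewrite rs_neq0 rs'_neq0.
Qed.

Lemma redM c d : vge 0 c -> vge 0 d -> red (c * d) = red c * red d.
Proof.
move=> /vge_frac [b [s [Ab As nPs ->]]] /vge_frac [b' [s' [Ab' As' nPs' ->]]].
rewrite mulf_div !red_frac ?rpredM //; last exact: P_prime_mul.
have [_ ->] := red_Oint As As'; have [_ ->] := red_Oint Ab Ab'.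
by rewrite mulf_div.
Qed.

Lemma red_sum I (s : seq I) (F : I -> L) : (forall i, vge 0 (F i)) ->
  red (\sum_(i <- s) F i) = \sum_(i <- s) red (F i).
Proof.
move=> vF; elim: s => [|i s IHs]; first by rewrite !big_nil red0.
by rewrite !big_cons redD ?vge_sum // IHs.
Qed.

Lemma vge1E c : vge 1 c = (c == 0) || (1 <= v c).
Proof.
by rewrite /vge -!gtz0_ge1 pmulr_rgt0.
Qed.

Lemma red_eq0 c : vge 0 c -> (red c = 0 <-> vge 1 c).
Proof.
move=> /vge_frac [b [s [Ab As nPs cE]]]; rewrite cE red_frac // vge1E.
have [s_neq0 rs_neq0] := (prime_notin_neq0 nPs, red_neq0 As nPs).
have -> : (red b / red s = 0) <-> P b.
  rewrite -(red_Oint_eq0 Ab); split=> [/eqP|->]; last by rewrite mul0r.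
  by rewrite mulf_eq0 invr_eq0 (negPf rs_neq0) orbF => /eqP.
have [->|b_neq0] := eqVneq b 0; first by rewrite mul0r eqxx; split=> // _; apply: is_ideal0.
have vs : v s = 0.
  apply: le_anti; rewrite leNgt; apply/andP; split.
    by apply/negP; rewrite gtz0_ge1 => /(v_ge1 As s_neq0).
  by apply/(v_ge0 s_neq0); exists s, 1; rewrite ?rpred1 ?divr1.
have [vM _] := v_val.
rewrite mulf_eq0 invr_eq0 (negPf b_neq0) (negPf s_neq0) /= vM ?invr_neq0 //.
by rewrite vV // vs subr0; apply: v_ge1.
Qed.

Lemma vge_strict l c : ~~ (e %| l)%N -> vge (- (l * v1)%N%:Z) c -> vge (1 - (l * v1)%N%:Z) c.
Proof.
move=> ndvd /predU1P [-> | vc]; first exact: vge0.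
rewrite /vge; apply/orP; right.
suff : e%:Z * v c != - (l * v1)%N%:Z by move: vc; lia.
apply: contraNneq ndvd => vE; rewrite -(Gauss_dvdl _ cop_e_v1).
by have := dvdz_mulr (v c) (dvdzz e%:Z); rewrite vE dvdzE abszN.
Qed.

(* The Gauss valuation on L[X] for which X has (scaled) value v1. *)
Definition Wge (w : int) (f : {poly L}) := forall l, vge (w - (l * v1)%N%:Z) f`_l.

Lemma Wge_le w w' f : w' <= w -> Wge w f -> Wge w' f.
Proof. by move=> le_w Wf l; apply: vge_le (Wf l); lia. Qed.

Lemma Wge0 w : Wge w 0. Proof. by move=> l; rewrite coef0 vge0. Qed.

Lemma WgeD w f h : Wge w f -> Wge w h -> Wge w (f + h).
Proof. by move=> Wf Wh l; rewrite coefD vgeD. Qed.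

Lemma Wge_sum w I (s : seq I) (F : I -> {poly L}) :
  (forall i, Wge w (F i)) -> Wge w (\sum_(i <- s) F i).
Proof. by move=> WF; apply: (big_ind (Wge w)); [exact: Wge0 | exact: WgeD | ]. Qed.

Lemma WgeM w w' f h : Wge w f -> Wge w' h -> Wge (w + w') (f * h).
Proof.
move=> Wf Wh l; rewrite coefM; apply: vge_sum => i.
apply: vge_le (vgeM (Wf i) (Wh (l - i)%N)); have := ltn_ord i; rewrite ltnS => le_i.
have : (i * v1 + (l - i) * v1 = l * v1)%N by rewrite -mulnDl subnKC.
by lia.
Qed.

Lemma WgeZXn w c l : vge (w - (l * v1)%N%:Z) c -> Wge w (c *: 'X^l).
Proof.
move=> vc i; rewrite coefZ coefXn; case: eqP => [-> | _]; first by rewrite mulr1.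
by rewrite mulr0 vge0.
Qed.

Lemma WgeC w c : vge w c -> Wge w c%:P.
Proof. by move=> vc; rewrite -[c%:P]mulr1 mul_polyC -(expr0 'X); apply: WgeZXn; rewrite subr0. Qed.

Lemma vge1 : vge 0 1. Proof. by rewrite /vge v1_eq0 mulr0 lexx orbT. Qed.

Lemma Wge1 : Wge 0 1. Proof. exact: WgeC vge1. Qed.

Lemma WgeN w f : Wge w f -> Wge w (- f).
Proof.
move=> Wf; rewrite -mulN1r -[w]add0r -polyCN; apply: WgeM Wf; apply: WgeC.
by apply/vge_frac; exists (-1), 1; rewrite ?rpredN ?rpred1 ?divr1.
Qed.

Lemma WgeB w f h : Wge w f -> Wge w h -> Wge w (f - h).
Proof. by move=> Wf Wh; apply: WgeD => //; apply: WgeN. Qed.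

Lemma WgeX w f n : Wge w f -> Wge (n%:Z * w) (f ^+ n).
Proof.
move=> Wf; elim: n => [|n IHn]; first by rewrite mul0r expr0; apply: Wge1.
by rewrite exprS (_ : _ * w = w + n%:Z * w); [apply: WgeM | lia].
Qed.

(* The leading form of f, with y standing for X^e / pi^v1; only meaningful when
   Wge 0 f. *)
Definition rho (f : {poly L}) : {poly k} :=
  \poly_(i < size f) red (f`_(e * i) * pi ^+ (v1 * i)).

Lemma coef_rho f i : (rho f)`_i = red (f`_(e * i) * pi ^+ (v1 * i)).
Proof.
rewrite coef_poly; case: ltnP => // le_i.
by rewrite nth_default ?mul0r ?red0 // (leq_trans le_i) // leq_pmull.
Qed.

Lemma Wge_coef_rho w f i : Wge w f -> vge w (f`_(e * i) * pi ^+ (v1 * i)).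
Proof.
by move=> Wf; apply: vge_le (vgeM (Wf (e * i)%N) (vge_pi (v1 * i))); lia.
Qed.

Lemma rhoD f h : Wge 0 f -> Wge 0 h -> rho (f + h) = rho f + rho h.
Proof.
by move=> Wf Wh; apply/polyP => i; rewrite coefD !coef_rho coefD mulrDl redD // Wge_coef_rho.
Qed.

Lemma rho_eq0 f : Wge 0 f -> (rho f = 0 <-> Wge 1 f).
Proof.
move=> Wf; split=> [rho0 l | Wf1]; last first.
  apply/polyP => i; rewrite coef_rho coef0.
  by apply/red_eq0; rewrite Wge_coef_rho.
have [/dvdnP [i lE]|ndvd] := boolP (e %| l)%N; last by apply: vge_strict; rewrite // -sub0r.
rewrite lE [(i * e)%N]mulnC.
have : vge 1 (f`_(e * i) * pi ^+ (v1 * i)).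
  by apply/red_eq0; rewrite ?Wge_coef_rho // -coef_rho rho0 coef0.
rewrite vge1E mulf_eq0 expf_eq0 (negPf pi_neq0) andbF orbF /vge.
have [//|f_neq0 /=] := eqVneq f`_(e * i) 0; have [vM _] := v_val.
rewrite vM ?expf_neq0 // vX // v_pi mulr1 => v_ge.
have : e%:Z * 1 <= e%:Z * (v f`_(e * i) + (v1 * i)%N) by rewrite ler_wpM2l.
rewrite mulrDr -PoszM [(v1 * i)%N]mulnC mulnA => v_ge'.
by rewrite lerBlDr; apply: le_trans v_ge'; rewrite mulr1.
Qed.

Lemma rhoN f : Wge 0 f -> rho (- f) = - rho f.
Proof.
move=> Wf; apply/eqP; rewrite -subr_eq0 opprK -rhoD //; last exact: WgeN.
rewrite addNr; apply/eqP/rho_eq0; exact: Wge0.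
Qed.

Lemma rhoB f h : Wge 0 f -> Wge 0 h -> rho (f - h) = rho f - rho h.
Proof. by move=> Wf Wh; rewrite rhoD ?rhoN //; apply: WgeN. Qed.

Lemma rhoC c : rho c%:P = (red c)%:P.
Proof.
apply/polyP => i; rewrite coef_rho !coefC muln_eq0 (gtn_eqF e_gt0) /=.
by case: eqP => [-> | _]; rewrite ?muln0 ?expr0 ?mulr1 // mul0r red0.
Qed.

Lemma rho1 : rho 1 = 1. Proof. by rewrite rhoC red1. Qed.

Lemma rhoM f h : Wge 0 f -> Wge 0 h -> rho (f * h) = rho f * rho h.
Proof.
move=> Wf Wh; apply/polyP => i; rewrite coef_rho !coefM mulr_suml.
have vG (l : 'I_(e * i).+1) w : vge (w - (l * v1)%N%:Z) f`_l ->
    vge w (f`_l * h`_(e * i - l) * pi ^+ (v1 * i)).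
  move=> vf; apply: vge_le (vgeM (vgeM vf (Wh _)) (vge_pi _)).
  have := ltn_ord l; rewrite ltnS => le_l.
  have : (e * (v1 * i) = l * v1 + (e * i - l) * v1)%N.
    by rewrite -mulnDl subnKC // -mulnA [(i * v1)%N]mulnC.
  by lia.
rewrite red_sum => [|l]; last exact: vG.
pose G l := if (e %| l)%N then red (f`_l * h`_(e * i - l) * pi ^+ (v1 * i)) else 0.
transitivity (\sum_(l < (e * i).+1) G l).
  apply: eq_bigr => l _; rewrite /G; case: ifP => // /negbT ndvd.
  apply/red_eq0; first exact: vG.
  by apply: vG; apply: vge_strict => //; have := Wf l; rewrite sub0r.
rewrite sum_multiples // => [|l /negPf ndvd]; last by rewrite /G ndvd.
apply: eq_bigr => j _; rewrite /G dvdn_mulr // !coef_rho.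
rewrite -redM ?Wge_coef_rho //; congr red; have := ltn_ord j; rewrite ltnS => le_j.
have -> : (v1 * i = v1 * j + v1 * (i - j))%N by rewrite -mulnDr subnKC.
by rewrite -mulnBr exprD; ring.
Qed.

Lemma rhoX f n : Wge 0 f -> rho (f ^+ n) = rho f ^+ n.
Proof.
move=> Wf; elim: n => [|n IHn]; first exact: rho1.
by rewrite !exprS rhoM ?IHn // -(mulr0 n%:Z); apply: WgeX.
Qed.

Definition ev (f : {poly L}) : M := (map_poly iota f).[gam].

Lemma evD f h : ev (f + h) = ev f + ev h. Proof. by rewrite /ev rmorphD hornerD. Qed.
Lemma evB f h : ev (f - h) = ev f - ev h. Proof. by rewrite /ev rmorphB hornerD hornerN. Qed.
Lemma evM f h : ev (f * h) = ev f * ev h. Proof. by rewrite /ev rmorphM hornerM. Qed.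
Lemma evC c : ev c%:P = iota c. Proof. by rewrite /ev map_polyC hornerC. Qed.
Lemma ev1 : ev 1 = 1. Proof. by rewrite evC rmorph1. Qed.
Lemma evXn f n : ev (f ^+ n) = ev f ^+ n. Proof. by rewrite /ev rmorphXn horner_exp. Qed.
Lemma evZXn c n : ev (c *: 'X^n) = iota c * gam ^+ n.
Proof. by rewrite /ev linearZ /= map_polyXn hornerZ hornerXn. Qed.

Let u0 := a / pi ^+ (g * v1).
Definition Rpoly : {poly k} := 'X^g - (red u0)%:P.
Let D : {poly L} := (pi ^+ (g * v1))^-1 *: 'X^(g * e) - u0%:P.

Let pin_neq0 n : pi ^+ n != 0. Proof. by rewrite expf_neq0. Qed.

Let vge_u0 : vge 0 u0.
Proof.
have [vM _] := v_val; rewrite /vge /u0 vM ?invr_neq0 // vV // vX // v_pi v_a; apply/orP; right.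
by lia.
Qed.

Let vge_piV n : vge (- (e * n)%N%:Z) (pi ^+ n)^-1.
Proof. by rewrite /vge vV // vX // v_pi; apply/orP; right; lia. Qed.

Lemma rhoZXn c i : rho (c *: 'X^(e * i)) = red (c * pi ^+ (v1 * i)) *: 'X^i.
Proof.
apply/polyP => j; rewrite coef_rho !coefZ !coefXn eqn_pmul2l //.
by case: eqP => [-> | _]; rewrite ?mulr1 // !mulr0 mul0r red0.
Qed.

Lemma WgeZXn_pi c i : vge 0 (c * pi ^+ (v1 * i)) -> Wge 0 (c *: 'X^(e * i)).
Proof.
move=> vc; apply: WgeZXn.
have := vgeM vc (vge_piV (v1 * i)); rewrite mulfK // add0r sub0r.
by apply: vge_le; lia.
Qed.

Let Wge_D : Wge 0 D.
Proof.
apply: WgeB; last exact: WgeC.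
rewrite [(g * e)%N]mulnC; apply: WgeZXn_pi.
by rewrite [(v1 * g)%N]mulnC mulVf //; apply: vge1.
Qed.

Let rho_D : rho D = Rpoly.
Proof.
rewrite rhoB; first last.
- exact: WgeC.
- rewrite [(g * e)%N]mulnC; apply: WgeZXn_pi.
  by rewrite [(v1 * g)%N]mulnC mulVf //; apply: vge1.
by rewrite rhoC [(g * e)%N]mulnC rhoZXn [(v1 * g)%N]mulnC mulVf // red1 scale1r.
Qed.

Let ev_D : ev D = 0.
Proof.
by rewrite evB evZXn evC gam_exp /u0 -rmorphM mulrC subrr.
Qed.

Let Wge_quot q : Wge 0 (q * D) -> Wge 0 q.
Proof.
move=> WqD.
suff q_l n l : (size q <= l + n)%N -> vge (0 - (l * v1)%N%:Z) q`_l.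
  by move=> l; apply: (q_l (size q)); rewrite leq_addl.
elim: n l => [|n IHn] l le_q.
  by rewrite nth_default ?vge0 // -[l]addn0.
have -> : q`_l = pi ^+ (g * v1) * (q * D)`_(l + g * e) + a * q`_(l + g * e).
  rewrite /D mulrBr -scalerAr [q * u0%:P]mulrC mul_polyC coefB !coefZ coefMXn.
  rewrite ltnNge leq_addl /= addnK /u0; field; exact: pin_neq0.
have IH : vge (0 - ((l + g * e) * v1)%N%:Z) q`_(l + g * e).
  apply: IHn; apply: leq_trans le_q _; rewrite -addnA leq_add2l -addn1 addnC leq_add2r.
  by rewrite muln_gt0 g_gt0.
apply: vgeD.
- by apply: vge_le (vgeM (vge_pi _) (WqD (l + g * e)%N)); lia.
- by apply: vge_le (vgeM vge_a IH); lia.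
Qed.

Lemma ker_rho f : Wge 0 f -> ev f = 0 -> Rpoly %| rho f.
Proof.
move=> Wf /gam_min /dvdpP [q fE].
have {}fE : f = (pi ^+ (g * v1) *: q) * D.
  rewrite fE /D -scalerAl scalerAr scalerBr scalerA divff // scale1r /u0.
  by rewrite -mul_polyC -polyCM [pi ^+ _ * _]mulrC divfK.
by rewrite fE rhoM ?rho_D ?dvdp_mull //; apply: Wge_quot; rewrite -fE.
Qed.

(* The quotient filtration on M = L[X] / (X^n0 - a). *)
Definition MW (w : int) (x : M) := exists f, Wge w f /\ ev f = x.

Lemma MW_le w w' x : w' <= w -> MW w x -> MW w' x.
Proof. by move=> le_w [f [Wf fx]]; exists f; split=> //; apply: Wge_le Wf. Qed.

Lemma MW0 w : MW w 0.
Proof. by exists 0; split; [exact: Wge0 | rewrite evC rmorph0]. Qed.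

Lemma MWD w x y : MW w x -> MW w y -> MW w (x + y).
Proof.
by move=> [f [Wf <-]] [h [Wh <-]]; exists (f + h); split; [exact: WgeD | exact: evD].
Qed.

Lemma MWM w w' x y : MW w x -> MW w' y -> MW (w + w') (x * y).
Proof.
by move=> [f [Wf <-]] [h [Wh <-]]; exists (f * h); split; [exact: WgeM | exact: evM].
Qed.

Lemma MWC w c : vge w c -> MW w (iota c).
Proof. by move=> vc; exists c%:P; split; [exact: WgeC | exact: evC]. Qed.

Lemma MWX w x n : MW w x -> MW (n%:Z * w) (x ^+ n).
Proof.
by move=> [f [Wf <-]]; exists (f ^+ n); split; [exact: WgeX | exact: evXn].
Qed.

Lemma vge_Oint c : c \in A -> vge 0 c.
Proof. by move=> Ac; apply/vge_frac; exists c, 1; rewrite rpred1 divr1. Qed.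

Lemma MWP q : P q -> MW e (iota q).
Proof.
move=> Pq; apply: MWC; rewrite /vge; have [//|q_neq0 /=] := eqVneq q 0.
have Aq : q \in A by apply: ideal_Oint Pq.
have := (v_ge1 Aq q_neq0).1 Pq => vq.
by rewrite -{1}[e%:Z]mulr1 ler_wpM2l.
Qed.

Lemma rho_lift (q : {poly k}) : exists f, Wge 0 f /\ rho f = q.
Proof.
suff [f [Wf fE]] : exists f, Wge 0 f /\ rho f = \sum_(i < size q) q`_i *: 'X^i.
  by exists f; split; rewrite // fE -[RHS]coefK poly_def.
elim: (size q) => [|n [f [Wf fE]]].
  exists 0; split; first exact: Wge0.
  by rewrite big_ord0; apply/rho_eq0; exact: Wge0.
have [c Ac cE] : exists2 c, c \in A & red c = q`_n.
  by case: red_residue => _ _ _ /(_ q`_n) [c /OintP Ac cE] _; exists c.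
have vc : vge 0 (c / pi ^+ (v1 * n) * pi ^+ (v1 * n)).
  by rewrite divfK //; apply: vge_Oint.
exists (f + (c / pi ^+ (v1 * n)) *: 'X^(e * n)); have Wc := WgeZXn_pi vc.
split; first exact: WgeD.
by rewrite rhoD // fE rhoZXn divfK // cE big_ord_recr.
Qed.

Lemma rho_dvd_MW1 f : Wge 0 f -> Rpoly %| rho f -> MW 1 (ev f).
Proof.
move=> Wf /dvdpP [q rho_f].
have [h [Wh rho_h]] := rho_lift q.
exists (f - h * D); have WhD : Wge 0 (h * D) by rewrite -[0]addr0; apply: WgeM.
split; last by rewrite evB evM ev_D mulr0 subr0.
apply/rho_eq0; first exact: WgeB.
by rewrite rhoB // rhoM // rho_h rho_D rho_f subrr.
Qed.

Lemma vgeX w c n : vge w c -> vge (n%:Z * w) (c ^+ n).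
Proof.
move=> vc; elim: n => [|n IHn]; first by rewrite mul0r expr0; apply: vge1.
by rewrite exprS (_ : _ * w = w + n%:Z * w); [apply: vgeM | lia].
Qed.

Lemma Rpoly_separable : separable_poly Rpoly.
Proof.
apply: separable_Xn_sub_const => //; apply/eqP => /(red_eq0 vge_u0).
have [vM _] := v_val.
rewrite vge1E /u0 mulf_eq0 invr_eq0 (negPf a_neq0) (negPf (pin_neq0 _)) /=.
by rewrite vM ?invr_neq0 // vV // vX // v_pi v_a; lia.
Qed.

Let gam_neq0 : gam != 0.
Proof.
have : gam ^+ (g * e) != 0 by rewrite gam_exp fmorph_eq0.
by rewrite expf_eq0 muln_gt0 g_gt0 e_gt0.
Qed.

(* With r v1 - t e = 1, the monomial gam^r / pi^t has the smallest positive value. *)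
Lemma MW_uniformizer : exists Pi, [/\ Pi != 0, MW 1 Pi & MW (-1) Pi^-1].
Proof.
have [r [t rt]] : exists (r : nat) (t : int), r%:Z * v1%:Z - t * e%:Z = 1.
  have [u [w uw]] : exists u w : int, u * e%:Z + w * v1%:Z = 1.
    by have /coprimezP [[u w] /= uw] : coprimez e v1 by []; exists u, w.
  have wr : 0 <= w + e%:Z * `|w|%N%:Z by move: e_gt0; nia.
  exists (absz (w + e%:Z * `|w|%N%:Z)), (`|w|%N%:Z * v1%:Z - u).
  by rewrite gez0_abs // -[RHS]uw; ring.
have [vM _] := v_val.
have pit_neq0 s : pi ^ s != 0 by rewrite expfz_neq0.
exists (iota (pi ^ (- t)) * gam ^+ r); split.
- by rewrite mulf_neq0 ?fmorph_eq0 // expf_neq0.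
- exists (pi ^ (- t) *: 'X^r); split; last exact: evZXn.
  apply: WgeZXn; rewrite /vge vXz // v_pi; apply/orP; right.
  by rewrite PoszM mulr1 -rt le_eqVlt; apply/orP; left; apply/eqP; ring.
- exists ((pi ^ t / a ^+ r) *: 'X^((g * e).-1 * r)); split.
    apply: WgeZXn; rewrite /vge vM ?invr_neq0 ?expf_neq0 // vV ?expf_neq0 // vX // vXz //.
    rewrite v_pi v_a; apply/orP; right.
    have ge_pred : (g * e).-1%:Z = g%:Z * e%:Z - 1.
      by rewrite -subn1 -subzn ?muln_gt0 ?g_gt0 // PoszM.
    by rewrite !PoszM mulr1 -rt ge_pred le_eqVlt; apply/orP; left; apply/eqP; ring.
  rewrite evZXn invfM -[in RHS]fmorphV invr_expz opprK rmorphM fmorphV rmorphXn -gam_exp -!mulrA.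
  congr (_ * _); rewrite -exprM -[in X in X^-1 * _](prednK (_ : 0 < g * e)%N) ?muln_gt0 ?g_gt0 //.
  rewrite mulSn exprD invfM -mulrA mulVf ?mulr1 //.
  by rewrite expf_neq0.
Qed.

Lemma MW_sum w I (s : seq I) (F : I -> M) :
  (forall i, MW w (F i)) -> MW w (\sum_(i <- s) F i).
Proof. by move=> WF; apply: (big_ind (MW w)); [exact: MW0 | exact: MWD | ]. Qed.

Lemma MW_reduced x n : MW 0 x -> MW 1 (x ^+ n) -> MW 1 x.
Proof.
move=> [f [Wf <-]] [h [Wh hE]]; apply: rho_dvd_MW1 => //.
apply: (@dvdp_exp_separable _ _ _ n Rpoly_separable).
have Wh0 : Wge 0 h by apply: Wge_le Wh.
have Wfn : Wge 0 (f ^+ n) by have := WgeX n Wf; rewrite mulr0.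
rewrite -rhoX // -[rho _]subr0 -(rho_eq0 Wh0).2 // -rhoB //.
by apply: ker_rho; [exact: WgeB | rewrite evB evXn hE subrr].
Qed.

Lemma MW_exists x : exists N : nat, MW (- N%:Z) x.
Proof.
have [f <-] := gam_gen x; rewrite -[_.[gam]]/(ev f).
have [N WN] : exists N : nat, forall l, (l < size f)%N -> vge (- N%:Z - (l * v1)%N%:Z) f`_l.
  elim: (size f) => [|n [N WN]]; first by exists 0%N.
  exists (maxn N `|(e%:Z * v f`_n)%R|%N) => l; rewrite ltnS leq_eqVlt => /predU1P [-> | /WN vl].
    by rewrite /vge; apply/orP; right; lia.
  by apply: vge_le vl; lia.
exists N, f; split=> // l; have [/WN //|le_l] := ltnP l (size f).
by rewrite nth_default ?vge0.
Qed.

(* With z = Pi^(N+1) x of value >= 0 and d the degree of an integral equation of x,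
   the equation multiplied by Pi^((N+1) d) shows that z^d has positive value. *)
Lemma MW_Oint x : x \in B -> MW 0 x.
Proof.
move=> /OintP [q q_mon qx]; have [Pi [Pi_neq0 MPi MPiV]] := MW_uniformizer.
have [N] := MW_exists x; elim: N => [|N IHN] // Mx; apply: IHN.
pose z := Pi ^+ N.+1 * x.
have Mz : MW 0 z.
  by rewrite -[0](_ : N.+1%:Z * 1 + - N.+1%:Z = 0); [apply: MWM => //; apply: MWX | lia].
have Mz1 : MW 1 z.
  pose d := (size q).-1; apply: (@MW_reduced z d) => //.
  have q_d : q`_d = 1 by move/monicP: q_mon.
  have sz_q : size q = d.+1 by rewrite prednK // size_poly_gt0 monic_neq0.
  have rel : x ^+ d = - \sum_(i < d) (q`_i)%:~R * x ^+ i.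
    move: qx; rewrite /root horner_coef size_map_poly_id0; last first.
      by rewrite lead_coefE -/d q_d oner_neq0.
    rewrite sz_q big_ord_recr /= coef_map_id0 // q_d mul1r addrC addr_eq0 => /eqP ->.
    by congr (- _); apply: eq_bigr => i _; rewrite coef_map_id0.
  have -> : z ^+ d = \sum_(i < d) iota (- (q`_i)%:~R) * (z ^+ i * Pi ^+ (N.+1 * (d - i))).
    rewrite exprMn rel mulrN mulr_sumr -sumrN; apply: eq_bigr => i _.
    rewrite rmorphN rmorph_int mulNr; congr (- _).
    rewrite exprMn -!exprM -{1}(subnKC (ltnW (ltn_ord i))) mulnDr exprD; ring.
  apply: MW_sum => i; rewrite -[1]add0r; apply: MWM.
    by apply: MWC; apply: vge_Oint; rewrite rpredN Oint_int.
  rewrite -[1]add0r; apply: MWM; first by have := MWX i Mz; rewrite mulr0.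
  apply: MW_le (MWX _ MPi); rewrite mulr1 lez_nat muln_gt0 /=.
  by rewrite subn_gt0.
have -> : x = (Pi^-1) ^+ N.+1 * z by rewrite /z mulrA -exprMn mulVf // expr1n mul1r.
by apply: MW_le (MWM (MWX _ MPiV) Mz1); lia.
Qed.

Let iota_Oint c : (iota c \in B) = (c \in A). Proof. exact: Oint_rmorph. Qed.

Lemma MW_clear x : MW 0 x -> exists s, [/\ s \in A, ~ P s & iota s * x \in B].
Proof.
move=> [f [Wf <-]].
rewrite /ev horner_coef size_map_poly.
apply: (big_ind (fun x => exists s, [/\ s \in A, ~ P s & iota s * x \in B])).
- by exists 1; rewrite rpred1 mulr0 rpred0.
- move=> y z [s [As nPs Bsy]] [s' [As' nPs' Bsz]]; exists (s * s'); split.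
  + exact: rpredM.
  + exact: P_prime_mul.
  + have -> : iota (s * s') * (y + z) = iota s' * (iota s * y) + iota s * (iota s' * z).
      by rewrite rmorphM; ring.
    by apply: rpredD; apply: rpredM; rewrite // iota_Oint.
- move=> l _; rewrite coef_map /=; pose n := (g * e)%N.
  have n_gt0 : (0 < n)%N by rewrite muln_gt0 g_gt0.
  have : vge 0 (f`_l ^+ n * a ^+ l).
    have := vgeM (vgeX n (Wf l)) (vgeX l vge_a); congr vge.
    by rewrite /n !PoszM; ring.
  move=> /vge_frac [b [s [Ab As nPs cE]]]; exists s; split=> //.
  apply: (@Oint_expr_root _ _ n n_gt0).
  have s_neq0 := prime_notin_neq0 nPs.
  have -> : (iota s * (iota f`_l * gam ^+ l)) ^+ n = iota (s ^+ n.-1 * b).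
    have -> : s ^+ n.-1 * b = s ^+ n * (f`_l ^+ n * a ^+ l).
      by rewrite cE -[in RHS](prednK n_gt0) exprS; field.
    by rewrite !rmorphM !rmorphXn /= -gam_exp -/n !exprMn -!exprM [(l * n)%N]mulnC.
  by rewrite iota_Oint rpredM ?rpredX.
Qed.

Lemma localizeM (J : set M) N s x : is_ideal J -> (forall q, P q -> J (iota q ^+ N)) ->
  s \in A -> ~ P s -> x \in B -> J (iota s * x) -> J x.
Proof. exact: (ideal_localization P_ideal P_max). Qed.

Definition Ipow (w : int) : set M := [set x | x \in B /\ MW w x].

Lemma Ipow_ideal w : is_ideal (Ipow w).
Proof.
split=> [x [/OintP] // | | x y [Bx Mx] [By My] | x y /OintP Bx [By My]].
- by split; [exact: rpred0 | exact: MW0].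
- by split; [exact: rpredD | exact: MWD].
- by split; [exact: rpredM | rewrite -[w]add0r; apply: MWM => //; apply: MW_Oint].
Qed.

Lemma Ipow_clear w x : 0 <= w -> MW w x ->
  exists s, [/\ s \in A, ~ P s & Ipow w (iota s * x)].
Proof.
move=> w_ge0 Mx; have [s [As nPs Bsx]] := MW_clear (MW_le w_ge0 Mx).
exists s; split=> //; split=> //; rewrite -[w]add0r; apply: MWM => //.
by apply: MWC; apply: vge_Oint.
Qed.

Let PB q : P q -> iota q \in B.
Proof. by move=> /(ideal_Oint P_ideal); rewrite iota_Oint. Qed.

Let Ipow_P q : P q -> Ipow e (iota q).
Proof. by move=> Pq; split; [exact: PB | exact: MWP]. Qed.

Let Ipow1_P q : P q -> Ipow 1 (iota q).
Proof. by move=> Pq; split; [exact: PB | apply: MW_le (MWP Pq)]. Qed.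

Lemma ideal_exp_Ipow n : ideal_exp (Ipow 1) n = Ipow n.
Proof.
elim: n => [|n IHn].
  apply/seteqP; split=> x; last by move=> [/OintP].
  by move=> /OintP Bx; split=> //; apply: MW_Oint.
rewrite /ideal_exp iterS -/(ideal_exp (Ipow 1) n) IHn.
apply/seteqP; split.
  apply: ideal_mul_sub => [|x y|x y [Bx Mx] [By My]].
  - exact: (is_ideal0 (Ipow_ideal _)).
  - exact: (is_idealD (Ipow_ideal _)).
  - by split; [exact: rpredM | rewrite -add1n PoszD; apply: MWM].
move=> x [Bx Mx]; have [Pi [Pi_neq0 MPi MPiV]] := MW_uniformizer.
have [s1 [As1 nPs1 I1]] := Ipow_clear ler01 MPi.
have [||s2 [As2 nPs2 I2]] := @Ipow_clear n (Pi^-1 * x) => //.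
  by apply: MW_le (MWM MPiV Mx); lia.
apply: (@localizeM _ n.+1 (s1 * s2)) => //.
- exact: ideal_mul_ideal (Ipow_ideal _) (Ipow_ideal _).
- move=> q /Ipow1_P Iq; rewrite exprS; apply: ideal_mul_mem => //.
  by rewrite -IHn; apply: ideal_exp_mem.
- exact: rpredM.
- exact: P_prime_mul.
- have -> : iota (s1 * s2) * x = (iota s1 * Pi) * (iota s2 * (Pi^-1 * x)).
    by rewrite rmorphM; field.
  exact: ideal_mul_mem.
Qed.

Lemma ideal_ext_ideal : is_ideal (ideal_ext iota P).
Proof.
split.
- move=> _ [s [sP ->]]; apply/OintP; rewrite big_seq; apply: rpred_sum => u /sP [Pu /OintP Bu].
  by rewrite rpredM ?PB.
- by exists [::]; rewrite big_nil.
- move=> _ _ [s [sP ->]] [s' [sP' ->]]; exists (s ++ s'); rewrite big_cat; split=> // u.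
  by rewrite mem_cat => /orP [/sP | /sP'].
- move=> x _ /OintP Bx [s [sP ->]]; exists [seq (u.1, x * u.2) | u <- s].
  rewrite big_map mulr_sumr; split=> [_ /mapP [u /sP [Pu /OintP Bu] ->] /= |].
    by split=> //; apply/OintP/rpredM.
  by apply: eq_bigr => u _; rewrite mulrCA.
Qed.

Let ideal_ext_mem q x : P q -> x \in B -> ideal_ext iota P (iota q * x).
Proof.
move=> Pq /OintP Bx; exists [:: (q, x)]; rewrite big_seq1; split=> // u.
by rewrite inE => /eqP ->.
Qed.

Lemma ideal_ext_Ipow : ideal_ext iota P = Ipow e.
Proof.
apply/seteqP; split.
  move=> _ [s [sP ->]]; rewrite big_seq.
  apply: (big_ind (Ipow e)) => [|x y|u /sP [Pu /OintP Bu]].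
  - exact: (is_ideal0 (Ipow_ideal _)).
  - exact: (is_idealD (Ipow_ideal _)).
  - exact: (is_idealMr (Ipow_ideal e) (Ipow_P Pu) Bu).
move=> x [Bx Mx].
have MpiV : MW (- e%:Z) (iota pi^-1).
  by apply: MWC; rewrite /vge vV // v_pi; apply/orP; right; lia.
have [s1 [As1 nPs1 Bs1]] : exists s, [/\ s \in A, ~ P s & iota s * (iota pi^-1 * x) \in B].
  by apply: MW_clear; have := MWM MpiV Mx; rewrite addNr.
have [b [s2 [Ab As2 nPs2 piE]]] : exists b s, [/\ b \in A, s \in A, ~ P s & pi = b / s].
  by apply/v_ge0; rewrite ?v_pi.
have s2_neq0 := prime_notin_neq0 nPs2.
have Pb : P b.
  have bE : b = s2 * pi by rewrite piE; field.
  have b_neq0 : b != 0 by rewrite bE mulf_neq0.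
  apply/(v_ge1 Ab b_neq0); have [vM _] := v_val.
  have : 0 <= v s2 by apply/(v_ge0 s2_neq0); exists s2, 1; rewrite ?rpred1 ?divr1.
  by rewrite bE vM // v_pi; lia.
apply: (@localizeM _ 1 (s1 * s2)) => //.
- exact: ideal_ext_ideal.
- by move=> q Pq; rewrite -[_ ^+ 1]mulr1; apply: ideal_ext_mem; rewrite ?rpred1.
- exact: rpredM.
- exact: P_prime_mul.
- have -> : iota (s1 * s2) * x = iota b * (iota s1 * (iota pi^-1 * x)).
    have -> : b = s2 * pi by rewrite piE; field.
    by rewrite !rmorphM fmorphV; field; rewrite fmorph_eq0.
  exact: ideal_ext_mem.
Qed.

Definition Qideal (h : {poly k}) : set M :=
  [set x | x \in B /\ exists f, [/\ Wge 0 f, ev f = x & h %| rho f]].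

Lemma Qideal_dvd h x f : h %| Rpoly -> Qideal h x -> Wge 0 f -> ev f = x -> h %| rho f.
Proof.
move=> hR [_ [f' [Wf' <- hf']]] Wf fE.
rewrite -[f](subrK f') rhoD //; last exact: WgeB.
rewrite dvdp_addl // (dvdp_trans hR) //.
by apply: ker_rho; [exact: WgeB | rewrite evB fE subrr].
Qed.

Lemma Qideal_ideal h : is_ideal (Qideal h).
Proof.
split=> [x [/OintP] // | | x y | x y /OintP Bx].
- split; first exact: rpred0.
  exists 0; split; [exact: Wge0 | by rewrite evC rmorph0 |].
  by rewrite (rho_eq0 (Wge0 0)).2 ?dvdp0 //; apply: Wge0.
- move=> [Bx [f [Wf fE hf]]] [By [f' [Wf' fE' hf']]]; split; first exact: rpredD.
  exists (f + f'); split; [exact: WgeD | by rewrite evD fE fE' | ].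
  by rewrite rhoD // dvdp_addr.
- move=> [By [f' [Wf' fE' hf']]]; split; first exact: rpredM.
  have [f [Wf fE]] := MW_Oint Bx.
  exists (f * f'); split; [by rewrite -[0]addr0; apply: WgeM | by rewrite evM fE fE' |].
  by rewrite rhoM // dvdp_mull.
Qed.

Lemma Qideal_clear h f : Wge 0 f -> h %| rho f ->
  exists s, [/\ s \in A, ~ P s & Qideal h (iota s * ev f)].
Proof.
move=> Wf hf; have [s [As nPs Bsx]] : exists s, [/\ s \in A, ~ P s & iota s * ev f \in B].
  by apply: MW_clear; exists f.
exists s; split=> //; split=> //; exists (s%:P * f).
have Ws : Wge 0 s%:P by apply: WgeC; apply: vge_Oint.
split; [by rewrite -[0]addr0; apply: WgeM | by rewrite evM evC |].
by rewrite rhoM // dvdp_mull.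
Qed.

Lemma Ipow1_Qideal h x : Ipow 1 x -> Qideal h x.
Proof.
move=> [Bx [f [Wf fE]]]; have Wf0 : Wge 0 f by apply: Wge_le Wf.
by split=> //; exists f; split=> //; rewrite (rho_eq0 Wf0).2 ?dvdp0.
Qed.

Lemma Qideal_R : Qideal Rpoly = Ipow 1.
Proof.
apply/seteqP; split=> x; last exact: Ipow1_Qideal.
by move=> [Bx [f [Wf fE Rf]]]; split=> //; rewrite -fE; apply: rho_dvd_MW1.
Qed.

Lemma Qideal_1 : Qideal 1 = @ringInt M.
Proof.
apply/seteqP; split=> x; first by move=> [/OintP].
move=> /OintP Bx; split=> //; have [f [Wf fE]] := MW_Oint Bx.
by exists f; split; rewrite ?dvd1p.
Qed.

Lemma Qideal_mul h h' : coprimep h h' -> Qideal (h * h') = ideal_mul (Qideal h) (Qideal h').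
Proof.
move=> cop; apply/seteqP; split; last first.
  apply: ideal_mul_sub => [|x y|x y].
  - exact: (is_ideal0 (Qideal_ideal _)).
  - exact: (is_idealD (Qideal_ideal _)).
  - move=> [Bx [f [Wf fE hf]]] [By [f' [Wf' fE' hf']]]; split; first exact: rpredM.
    exists (f * f'); split; [by rewrite -[0]addr0; apply: WgeM | by rewrite evM fE fE' |].
    by rewrite rhoM // dvdp_mul.
move=> x Qx; have [Bx [f [Wf fE hf]]] := Qx.
have [[u u'] /= uE] := Bezout_eq1_coprimepP _ _ cop.
have [f2 [Wf2 rf2]] := rho_lift (u' * h').
have W1f2 : Wge 0 (1 - f2) by apply: WgeB => //; apply: Wge1.
have [|s1 [As1 nPs1 Q1]] := @Qideal_clear h _ W1f2.
  by rewrite rhoB ?rho1 ?rf2 -?uE ?addrK ?dvdp_mull //; apply: Wge1.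
have [|s2 [As2 nPs2 Q2]] := @Qideal_clear h' _ Wf2; first by rewrite rf2 dvdp_mull.
have sub t t' : t %| t' -> Qideal t' `<=` Qideal t.
  by move=> tt' y [By [f' [Wf' fE' hf']]]; split=> //; exists f'; split=> //; apply: dvdp_trans hf'.
apply: (@localizeM _ 2 (s1 * s2)) => //.
- exact: ideal_mul_ideal (Qideal_ideal _) (Qideal_ideal _).
- by move=> q /Ipow1_P Iq; rewrite expr2; apply: ideal_mul_mem; apply: Ipow1_Qideal.
- exact: rpredM.
- exact: P_prime_mul.
have -> : iota (s1 * s2) * x =
    iota s2 * ((iota s1 * ev (1 - f2)) * x) + iota s1 * (x * (iota s2 * ev f2)).
  by rewrite rmorphM evB ev1; ring.
have idQ := ideal_mul_ideal (Qideal_ideal h) (Qideal_ideal h').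
apply: (is_idealD idQ); apply: (is_idealMl idQ); rewrite ?iota_Oint //.
- by apply: ideal_mul_mem => //; apply: sub Qx; apply: dvdp_mull.
- by apply: ideal_mul_mem => //; apply: sub Qx; apply: dvdp_mulr.
Qed.

Lemma Qideal_prod s (h : 'I_s -> {poly k}) : \prod_(j < s) h j %| Rpoly ->
  Qideal (\prod_(j < s) h j) = ideal_prod (fun j => Qideal (h j)).
Proof.
rewrite /ideal_prod; elim: s h => [|s IHs] h hR; first by rewrite !big_ord0 Qideal_1.
rewrite !big_ord_recl /= in hR *; rewrite Qideal_mul.
  by rewrite IHs // (dvdp_trans _ hR) // dvdp_mull.
exact: (separable_coprime Rpoly_separable).
Qed.

Section PrimeFactor.
Variable h : {poly k}.
Hypotheses (h_irr : irreducible_poly h) (hR : h %| Rpoly).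

Lemma irreducible_ndvd_const c : (h %| c%:P) = (c == 0).
Proof.
have [->|c_neq0] := eqVneq c 0; first by rewrite dvdp0.
apply/negP => /dvdp_leq; rewrite polyC_eq0 c_neq0 size_polyC c_neq0 => /(_ isT).
by case: h_irr => /leq_trans lt1 _ /lt1.
Qed.

Lemma Qideal_iota c : Qideal h (iota c) <-> P c.
Proof.
split=> [Qc | Pc]; last by apply: Ipow1_Qideal; apply: Ipow1_P.
have Ac : c \in A by have := ideal_Oint (Qideal_ideal h) Qc; rewrite iota_Oint.
apply/(red_Oint_eq0 Ac)/eqP; rewrite -irreducible_ndvd_const -rhoC.
by apply: (Qideal_dvd hR Qc); [apply: WgeC; apply: vge_Oint | exact: evC].
Qed.

Lemma Qideal_lies_over : lies_over iota P (Qideal h).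
Proof. by apply/seteqP; split=> c /= /Qideal_iota. Qed.

Lemma Qideal_prime : (exists2 x, P x & x != 0) -> is_prime (Qideal h).
Proof.
move=> [q Pq q_neq0]; split.
- exact: Qideal_ideal.
- by exists (iota q); [apply/Qideal_iota | rewrite fmorph_eq0].
- by rewrite -(rmorph1 iota) => /Qideal_iota.
- move=> x y /OintP Bx /OintP By Qxy.
  have [f [Wf fE]] := MW_Oint Bx; have [f' [Wf' fE']] := MW_Oint By.
  have : h %| rho f * rho f'.
    rewrite -rhoM //; apply: (Qideal_dvd hR Qxy); last by rewrite evM fE fE'.
    by rewrite -[0]addr0; apply: WgeM.
  have [hf _|nhf] := boolP (h %| rho f); first by left; split=> //; exists f.
  rewrite Gauss_dvdpr; last by rewrite irreducible_poly_coprime.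
  by right; split=> //; exists f'.
Qed.

Lemma Qideal_residue_degree : residue_degree iota P (Qideal h) (size h).-1.
Proof.
set d := (size h).-1; have h_neq0 := irredp_neq0 h_irr.
pose th i := (pi ^+ (v1 * i))^-1 *: 'X^(e * i) : {poly L}.
have Wth i : Wge 0 (th i) by apply: WgeZXn_pi; rewrite mulVf //; apply: vge1.
have rho_th i : rho (th i) = 'X^i by rewrite rhoZXn mulVf // red1 scale1r.
have [s [s_int s_notin sB]] : exists s : 'I_d -> L, [/\ forall i, s i \in A,
    forall i, ~ P (s i) & forall i, iota (s i) * ev (th i) \in B].
  have /fin_all_exists [s sP] (i : 'I_d) : exists s, [/\ s \in A, ~ P s & iota s * ev (th i) \in B].
    by apply: MW_clear; exists (th i).
  by exists s; split=> i; case: (sP i).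
have Wcomb (c : 'I_d -> L) : (forall i, c i \in A) ->
    Wge 0 (\sum_(i < d) (c i * s i)%:P * th i).
  move=> Ac; apply: Wge_sum => i; rewrite -[0]addr0; apply: WgeM => //.
  by apply: WgeC; apply: vge_Oint; rewrite rpredM.
have rho_comb (c : 'I_d -> L) : (forall i, c i \in A) ->
    rho (\sum_(i < d) (c i * s i)%:P * th i) =
      \poly_(i < d) (if insub i is Some j then red (c j) * red (s j) else 0).
  move=> Ac; rewrite poly_def.
  have Wi i : Wge 0 ((c i * s i)%:P * th i).
    by rewrite -[0]addr0; apply: WgeM => //; apply: WgeC; apply: vge_Oint; rewrite rpredM.
  transitivity (\sum_(i < d) rho ((c i * s i)%:P * th i)).
    elim: (index_enum _) => [|i l IHl].
      by rewrite !big_nil; apply/rho_eq0; exact: Wge0.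
    by rewrite !big_cons rhoD ?IHl //; apply: Wge_sum.
  apply: eq_bigr => i _; rewrite valK rhoM //; last by apply: WgeC; apply: vge_Oint; rewrite rpredM.
  by rewrite rhoC rho_th mul_polyC; have [_ ->] := red_Oint (Ac i) (s_int i).
have ev_comb (c : 'I_d -> L) :
    ev (\sum_(i < d) (c i * s i)%:P * th i) =
      \sum_(i < d) iota (c i) * (iota (s i) * ev (th i)).
  elim: (index_enum _) => [|i l IHl]; first by rewrite !big_nil evC rmorph0.
  by rewrite !big_cons evD IHl evM evC rmorphM mulrA.
exists (fun i => iota (s i) * ev (th i)); split.
- by move=> i; apply/OintP.
- move=> y /OintP By; have [f [Wf fE]] := MW_Oint By.
  pose q := rho f %% h.
  have /fin_all_exists2 [c Ac cE] (i : 'I_d) :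
      exists2 c, c \in A & red c = q`_i / red (s i).
    by case: red_residue => _ _ _ /(_ (q`_i / red (s i))) [c /OintP]; exists c.
  exists c => [i|]; first exact/OintP.
  split.
    apply: rpredB => //; apply: rpred_sum => i _; apply: rpredM => //.
    by rewrite iota_Oint.
  exists (f - \sum_(i < d) (c i * s i)%:P * th i).
  have Wc := Wcomb c Ac.
  split; [exact: WgeB | by rewrite evB fE ev_comb |].
  rewrite rhoB // rho_comb // (_ : \poly_(i < d) _ = q).
    by rewrite {1}(divp_eq (rho f) h) addrK dvdp_mull.
  apply/polyP => i; rewrite coef_poly; case: ltnP => [lt_i|le_i].
    by rewrite insubT /= cE divfK // red_neq0.
  rewrite nth_default // (leq_trans _ le_i) // -ltnS prednK ?size_poly_gt0 //.
  by rewrite ltn_modp.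
- move=> c c_int Qc i; have Ac j : c j \in A by apply/OintP.
  have := Qideal_dvd hR Qc (Wcomb c Ac) (ev_comb c); rewrite rho_comb //.
  set q := \poly_(i < d) _ => hq.
  have q0 : q = 0.
    apply/eqP; apply: contraTT hq => q_neq0; apply/negP => /(dvdp_leq q_neq0).
    rewrite leqNgt (leq_ltn_trans (size_poly _ _)) // /d prednK ?size_poly_gt0 //.
  have := congr1 (fun q' : {poly k} => q'`_i) q0.
  rewrite coef0 coef_poly ltn_ord valK => /eqP.
  by rewrite mulf_eq0 (negPf (red_neq0 (s_int i) (s_notin i))) orbF => /eqP /(red_Oint_eq0 (Ac i)).
Qed.

End PrimeFactor.

Lemma Qideal_inj h h' : irreducible_poly h -> irreducible_poly h' ->
  h \is monic -> h' \is monic -> h %| Rpoly -> h' %| Rpoly ->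
  Qideal h = Qideal h' -> h = h'.
Proof.
move=> h_irr h'_irr h_mon h'_mon hR h'R eqQ.
have [f [Wf fE]] := rho_lift h.
have [|s [As nPs Qs]] := @Qideal_clear h f Wf; first by rewrite fE dvdpp.
have Ws : Wge 0 s%:P by apply: WgeC; apply: vge_Oint.
have : h' %| rho (s%:P * f).
  apply: (@Qideal_dvd _ (iota s * ev f)) => //; first by rewrite -eqQ.
    by rewrite -[0]addr0; apply: WgeM.
  by rewrite evM evC.
rewrite rhoM // rhoC fE mul_polyC dvdpZr ?red_neq0 // => h'_h.
apply/eqP; rewrite -eqp_monic // eqp_sym.
apply: (apply_irredp h_irr) => //.
by case: h'_irr => /gtn_eqF ->.
Qed.

Lemma tame_Kummer_factorization : (exists2 x, P x & x != 0) ->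
  exists I : set M, [/\ is_ideal I, ideal_ext iota P = ideal_exp I e & mirrors iota P I Rpoly].
Proof.
move=> P_neq0; exists (Ipow 1); split; first exact: Ipow_ideal.
  by rewrite ideal_ext_Ipow ideal_exp_Ipow.
move=> s h h_inj h_irr RE; exists (fun j => Qideal (h j)).
have hR j : h j %| Rpoly by rewrite RE (bigD1 j) //= dvdp_mulr.
split.
- move=> i j eqQ; apply: h_inj; have [hi_mon hi_irr] := h_irr i; have [hj_mon hj_irr] := h_irr j.
  exact: Qideal_inj eqQ.
- move=> j; have [_ hj_irr] := h_irr j.
  by split; [exact: Qideal_prime | exact: Qideal_lies_over].
- by move=> j; have [_ hj_irr] := h_irr j; apply: Qideal_residue_degree.
- by rewrite -Qideal_prod -?RE ?Qideal_R.
Qed.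

End KummerTame.
(** * Degrees in the tower K, L, M *)

Section RadicalTower.
Variables (K : fieldType) (M : fieldExtType K) (L : {subfield M}).
Variables (a : K) (alpha : M) (n0 q : nat).
Hypotheses (n0_gt0 : (0 < n0)%N) (q_gt0 : (0 < q)%N) (cop : coprime n0 q).
Hypothesis irr_a : irreducible_poly ('X^(n0 * q) - a%:P).
Hypothesis alpha_root : alpha ^+ (n0 * q) = a%:A.
Hypothesis alpha_gen : <<1; alpha>>%VS = fullv.
Hypothesis L_def : (L : {vspace M}) = <<1; alpha ^+ n0>>%VS.

Let size_Xn_sub (F : fieldType) n (c : F) : (0 < n)%N -> size ('X^n - c%:P) = n.+1.
Proof. by move=> n_gt0; rewrite size_XnsubC. Qed.

Lemma dim_radical : \dim {:M} = (n0 * q)%N.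
Proof.
rewrite -alpha_gen dim_Fadjoin dimv1 muln1.
have /polyOver1P [r rE] := minPolyOver 1%AS alpha.
have r_dvd : r %| 'X^(n0 * q) - a%:P.
  rewrite -(dvdp_map (in_alg M)) -rE minPoly_dvdp //.
    by apply/polyOver1P; exists ('X^(n0 * q) - a%:P).
  rewrite rmorphB /= map_polyXn map_polyC /root !hornerE /=.
  by rewrite alpha_root subrr.
have size_r : size r = (adjoin_degree 1 alpha).+1.
  by rewrite -(size_minPoly 1%AS alpha) rE size_map_poly.
have /eqp_size : r %= 'X^(n0 * q) - a%:P.
  apply: (apply_irredp irr_a) => //.
  by rewrite size_r.
by rewrite size_r size_Xn_sub ?muln_gt0 ?n0_gt0 // => -[].
Qed.

Lemma dim_subradical : (\dim L <= q)%N.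
Proof.
rewrite L_def dim_Fadjoin dimv1 muln1 -ltnS -size_minPoly.
rewrite -(size_Xn_sub (a%:A : M) q_gt0); apply: dvdp_leq.
  by rewrite -size_poly_gt0 size_Xn_sub.
apply: (@minPoly_dvdp _ _ 1%AS).
  by rewrite rpredB ?rpredX ?polyOverX // polyOverC memvZ ?mem1v.
by rewrite /root !hornerE -exprM alpha_root subrr.
Qed.

Lemma radical_generator : <<L; alpha ^+ q>>%VS = fullv.
Proof.
apply/eqP; rewrite eqEsubv subvf -alpha_gen; apply/FadjoinP; split; first exact: sub1v.
case: (egcdnP q n0_gt0) => u w uw _; have /eqP gcd1 := cop.
have alpha_neq0 : alpha ^+ (w * q) != 0 \/ alpha = 0.
  by have [->|a_neq0] := eqVneq alpha 0; [right | left; rewrite expf_neq0].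
case: alpha_neq0 => [aw_neq0 | ->]; last exact: mem0v.
have alphaE : alpha = (alpha ^+ n0) ^+ u / (alpha ^+ q) ^+ w.
  rewrite -!exprM [(n0 * u)%N]mulnC [(q * w)%N]mulnC uw gcd1 exprD expr1.
  by rewrite mulrC mulKf.
rewrite [X in X \in _]alphaE; apply: rpred_div; apply: rpredX; last exact: memv_adjoin.
by apply: subvP_adjoin; rewrite L_def memv_adjoin.
Qed.

Let gam := alpha ^+ q.

Lemma radical_horner (x : M) : exists f : {poly subvs_of L}, (map_poly vsval f).[gam] = x.
Proof.
have /Fadjoin_polyP [r /polyOver_subvs [f ->] ->] : x \in <<L; gam>>%VS.
  by rewrite radical_generator memvf.
by exists f.
Qed.

Lemma radical_minPoly (f : {poly subvs_of L}) :
  (map_poly vsval f).[gam] = 0 -> 'X^n0 - (a%:A)%:P %| f.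
Proof.
move=> f0; pose D : {poly subvs_of L} := 'X^n0 - (a%:A)%:P.
have vD : map_poly vsval D = 'X^n0 - (a%:A)%:P :> {poly M}.
  rewrite rmorphB /= map_polyXn map_polyC /=.
  by rewrite algid1.
have min_dvd (h : {poly subvs_of L}) : root (map_poly vsval h) gam ->
    minPoly L gam %| map_poly vsval h.
  by apply: minPoly_dvdp; apply/polyOver_subvs; exists h.
have D_dvd : minPoly L gam %| map_poly vsval D.
  by apply: min_dvd; rewrite vD /root !hornerE -exprM mulnC alpha_root subrr.
have /eqp_dvdl eq_min : minPoly L gam %= map_poly vsval D.
  rewrite -dvdp_size_eqp // eqn_leq dvdp_leq //=; last first.
    by rewrite vD -size_poly_gt0 size_Xn_sub.
  rewrite vD size_Xn_sub // size_minPoly ltnS.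
  have := dim_Fadjoin L gam; rewrite radical_generator dim_radical => dimE.
  rewrite -(leq_pmul2r q_gt0) dimE leq_mul2l dim_subradical orbT //.
by rewrite -(dvdp_map (vsval : {rmorphism subvs_of L -> M})) -eq_min min_dvd //; apply/eqP.
Qed.

End RadicalTower.

Theorem theorem8p5
  (K : fieldExtType rat) (p : nat) (pp : set K)
  (* K_pp, inside an algebraically closed field Omega *)
  (Kp : fieldType) (iota : {rmorphism K -> Kp}) (w : Kp -> int)
  (Omega : closedFieldType) (eps : {rmorphism Kp -> Omega})
  (n n0 m h k : nat) (a a0 pi : K)
  (* M = K(alpha) with alpha^n = a, and L = K(alpha^n0) inside M *)
  (M : fieldExtType K) (alpha : M) (L : {subfield M})
  (PP : set (subvs_of L)) (kP : fieldType) (red : subvs_of L -> kP)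
  (piP : subvs_of L)
  (p_prime : prime p) (p_odd : odd p)
  (pp_prime : is_prime pp) (pp_above : above_rat p pp)
  (pp_ram : ~~ (p %| ram_index p pp)%Z)
  (Kp_completion : is_completion pp iota w)
  (Kp_cyclotomic :
     range eps `&` cyclotomic_tower p (eps @` padic_subfield w)
       = eps @` padic_subfield w)
  (n_def : n = (n0 * p ^ m)%N) (m_ge1 : (1 <= m)%N) (n0_p : ~~ (p %| n0)%N)
  (a_int : ringInt a)
  (irr_a : irreducible_poly ('X^n - a%:P))
  (a_def : a = a0 * pi ^+ (h * p ^ k))
  (pi_int : ringInt pi) (pi_val : vP pp pi = 1)
  (a0_neq0 : a0 != 0) (a0_val : vP pp a0 = 0)
  (h_p : ~~ (p %| h)%N) (k_ge1 : (1 <= k)%N)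
  (alpha_root : alpha ^+ n = a%:A) (alpha_gen : <<1; alpha>>%VS = fullv)
  (L_def : (L : {vspace M}) = <<1; alpha ^+ n0>>%VS)
  (PP_prime : is_prime PP)
  (PP_over : lies_over (in_alg (subvs_of L)) pp PP)
  (kP_residue : is_residue_field PP red)
  (piP_val : vP PP piP = 1) :
  let aL : subvs_of L := a%:A in
  let g := gcdn n0 `|vP PP aL|%N in
  exists I : set M,
    [/\ is_ideal I,
        ideal_ext (@vsval _ _ L) PP = ideal_exp I (n0 %/ g)
      & mirrors (@vsval _ _ L) PP I
          ('X^g - (red (aL / piP ^ vP PP aL))%:P)].
Proof.
move=> aL g.
have a_mem : a \in Oint K by apply/OintP.
have pi_neq0 : pi != 0 by apply: (vP_neq0 p_prime pp_prime pp_above); rewrite pi_val.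
have a_neq0 : a != 0 by rewrite a_def mulf_neq0 ?expf_neq0.
have aL_neq0 : aL != 0 by rewrite scaler_eq0 oner_eq0 orbF.
have PP_above : @above_rat (baseFieldType (subvs_of L)) p PP.
  rewrite /above_rat -pp_above -PP_over; apply/seteqP.
  by split=> z /=; rewrite /= -[_%:A]/(in_alg _ _) rmorph_int.
pose E : fieldExtType rat := baseFieldType (subvs_of L).
have PP_primeE : @is_prime E PP by [].
have aL_mem : aL \in Oint (subvs_of L).
  by rewrite -[aL]/(in_alg (subvs_of L) a) Oint_rmorph.
have v_val : is_valuation (vP PP) := vP_valuation p_prime PP_primeE PP_above.
have v_ge0 x : x != 0 -> (0 <= vP PP x <-> exists b s,
    [/\ b \in Oint (subvs_of L), s \in Oint (subvs_of L), ~ PP s & x = b / s]) :=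
  @vP_ge0 E p PP p_prime PP_primeE PP_above x.
have v_ge1 x : x \in Oint (subvs_of L) -> x != 0 -> (PP x <-> 1 <= vP PP x) :=
  @vP_ge1 E p PP p_prime PP_primeE PP_above x.
have piP_neq0 : piP != 0.
  by apply: (@vP_neq0 E p PP p_prime PP_primeE PP_above); rewrite [vP _ _]piP_val.
have n0_gt0 : (0 < n0)%N by case: (n0) n0_p => //; rewrite dvdn0.
have q_gt0 : (0 < p ^ m)%N by rewrite expn_gt0 prime_gt0.
have cop : coprime n0 (p ^ m) by rewrite coprimeXr // coprime_sym prime_coprime.
have g_gt0 : (0 < g)%N by rewrite gcdn_gt0 n0_gt0.
have n0E : n0 = (g * (n0 %/ g))%N by rewrite mulnC divnK ?dvdn_gcdl.
set e := (n0 %/ g)%N in n0E *.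
pose v1 := (`|vP PP aL| %/ g)%N.
have v_aL : vP PP aL = (g * v1)%N.
  rewrite mulnC divnK ?dvdn_gcdr // gez0_abs //.
  by apply/(v_ge0 _ aL_neq0); exists aL, 1; rewrite rpred1 divr1; split=> //; case: PP_prime.
have e_gt0 : (0 < e)%N by rewrite divn_gt0 // dvdn_leq ?dvdn_gcdl.
have cop_e_v1 : coprime e v1.
  have v1E : (g * v1 = `|vP PP aL|)%N by rewrite v_aL.
  by rewrite /coprime -(eqn_pmul2l g_gt0) muln1 muln_gcdr -n0E v1E.
have PP_ideal : is_ideal PP by case: PP_prime.
have PP_p : PP p%:R by apply/(above_ratE PP_above p).
have g_neq0 : g%:R != 0 :> kP.
  apply/eqP => g0.
  have red_nat i : red i%:R = i%:R.
    have [r1 rD _ _ _] := kP_residue.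
    elim: i => [|i IHi].
      by apply/(red_Oint_eq0 kP_residue (rpred0 _)); apply: is_ideal0.
    have [||redD1 _] := rD i%:R 1.
    - by apply/OintP; rewrite rpred_nat.
    - by apply/OintP; rewrite rpred1.
    - by rewrite -natr1 redD1 IHi r1 natr1.
  have p0 : p%:R = 0 :> kP by rewrite -red_nat; apply/(red_Oint_eq0 kP_residue (rpred_nat _ _)).
  have cop_g : coprime g p.
    rewrite coprime_sym prime_coprime //; apply: contra n0_p => /dvdn_trans -> //.
    exact: dvdn_gcdl.
  case: (egcdnP p g_gt0) => u u' uE _; have := congr1 (fun i => i%:R : kP) uE.
  by rewrite natrD !natrM g0 p0 !mulr0 add0r (eqP cop_g) => /esym/eqP; rewrite oner_eq0.
have alpha_root' : alpha ^+ (n0 * p ^ m) = a%:A by rewrite -n_def.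
have irr_a' : irreducible_poly ('X^(n0 * p ^ m) - a%:P) by rewrite -n_def.
have gamE : (alpha ^+ (p ^ m)) ^+ (g * e) = vsval aL.
  by rewrite -n0E -exprM mulnC alpha_root' /= algid1.
have := @tame_Kummer_factorization _ _ (vsval : {rmorphism subvs_of L -> M}) (vP PP) PP kP red
  piP aL (alpha ^+ (p ^ m)) g e v1 PP_ideal.
rewrite /Rpoly v_aL -exprnP; apply => //.
- by case: PP_prime.
- exact: (@prime_mul_notin E PP PP_primeE).
- exact: (@prime_maximal E p PP p_prime PP_primeE PP_above).
- exact: (radical_horner n0_gt0 cop alpha_gen L_def).
- rewrite -n0E; exact: (radical_minPoly n0_gt0 q_gt0 cop irr_a' alpha_root' alpha_gen L_def).
- by case: PP_prime.
Qed.
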